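(* Let $\lambda$ be a partition of $n$, let $T\in\mathsf{SYT}(\lambda)$, let $I=[i,i+2m]$ (with $m\geqslant 1$) be a Dyck pattern interval of $T$, let $k$ be the unpaired letter, and let $T'=I\cdot T=\mathsf{cycle}(I)\cdot T$ with $\mathsf{cycle}(I)=(m+k,m+k-1,\ldots,k)$, so that $T\stackrel{I}{\longrightarrow}T'$ is an edge of the crystal skeleton $\mathsf{CS}(\lambda)$. Let $\alpha$ and $\beta$ be the compositions with $T\in\mathsf{QCS}_\alpha$ and $T'\in\mathsf{QCS}_\beta$ (i.e. $\alpha$ is the shape of $\varphi^{-1}(T)$ and $\beta$ is the shape of $\varphi^{-1}(T')$). Then $\alpha\neq\beta$ if and only if both of the following hold: (I) the letters in $A:=[i,k]$ occur in the first $|A|=k-i+1$ columns of $T$, and $k>i$; and (II) if $i$ occurs in row $r_0$ of $T$, then $\alpha_{r_0+1}<\alpha_{r_0}$.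
   Context: Diagrams are in French notation: rows are numbered from bottom to top, columns from left to right. $\mathsf{SYT}(\lambda)$ is the set of standard Young tableaux of shape $\lambda$, $n=|\lambda|$. $[a,b]$ denotes the integer interval $\{a,a+1,\ldots,b\}$ and $[n]=[1,n]$. $\mathsf{row}(T)$ is the row reading word: rows are read from top to bottom, each row from left to right. For a word $\pi$ and an interval $J$, $\pi|_J$ is the subword of letters in $J$. Dyck pattern interval: with $\pi=\mathsf{row}(T)$, an interval $I=[i,i+2m]\subseteq[n]$ with $m\geqslant1$ is a Dyck pattern interval of $T$ if the RSK insertion tableaux of $\pi|_I$ and $\pi|_{[i,i+m]}$ have shapes $(m+1,m)$ and $(m+1)$, respectively. Set $I^-=[i,i+m]$, $I^+=[i+m+1,i+2m]$. Associate to each letter of $I^+$ in $\pi|_I$ an open bracket and to each letter of $I^-$ a closed bracket, and match brackets as usual; exactly one closed bracket is unpaired, and $k\in I^-$ denotes the corresponding letter. Let $\mathsf{cycle}(I)=(m+k,m+k-1,\ldots,k)$ be the cycle sending $k\mapsto k+m$ and $x\mapsto x-1$ for $k<x\leqslant k+m$ (all other letters are fixed), and let $I\cdot T:=\mathsf{cycle}(I)\cdot T$ be the tableau obtained by applying this permutation to the entries of $T$. Crystal skeleton $\mathsf{CS}(\lambda)$: the directed graph with vertex set $\mathsf{SYT}(\lambda)$ and an edge $T\stackrel{I}{\longrightarrow}I\cdot T$ for every Dyck pattern interval $I$ of $T$. Map $\varphi^{-1}$: for $T\in\mathsf{SYT}(\lambda)$, $\varphi^{-1}(T)$ is the filling of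 a composition diagram (row $r$ from the bottom has $\alpha_r$ left-justified cells, $\alpha$ a rearrangement of $\lambda$) built as follows. Write the leftmost column of $T$ increasing from bottom to top. Then place the entries of the second column of $T$ from smallest to largest, each into the highest unoccupied cell of the second column whose neighbor immediately to the left contains a smaller entry. Repeat with all subsequent columns from left to right. Quasicrystal skeleton $\mathsf{QCS}_\alpha$ ($\alpha$ a rearrangement of the parts of $\lambda$): the induced subgraph of $\mathsf{CS}(\lambda)$ on all $T\in\mathsf{SYT}(\lambda)$ such that $\varphi^{-1}(T)$ has shape $\alpha$. *)

(* Defs.v *)
From mathcomp Require Import all_boot.

Set Implicit Arguments.
Unset Strict Implicit.
Unset Printing Implicit Defensive.

(* Diagrams are in French notation: a filling is the list of its rows from
   bottom to top, each row being read from left to right.  Rows and columns are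
   indexed from 0, and so are the parts of a composition. *)
Definition filling := seq (seq nat).

Definition is_partition (la : seq nat) (n : nat) : bool :=
  [&& sorted geq la, 0 \notin la & sumn la == n].

Definition entry (T : filling) (r c : nat) : nat := nth 0 (nth [::] T r) c.

(* The c-th column, from bottom to top; rows of length at most c are skipped. *)
Definition column (T : filling) (c : nat) : seq nat :=
  [seq nth 0 row c | row <- T & c < size row].

Definition is_SYT (la : seq nat) (T : filling) : Prop :=
  [/\ shape T = la,
      perm_eq (flatten T) (iota 1 (sumn la)),
      (forall r c, c.+1 < nth 0 la r -> entry T r c < entry T r c.+1)
    & (forall r c, c < nth 0 la r.+1 -> entry T r c < entry T r.+1 c)].

Definition row_word (T : filling) : seq nat := flatten (rev T).

Definition restrict (w : seq nat) (a b : nat) : seq nat :=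
  [seq x <- w | a <= x <= b].

(* Schensted row insertion; the second component is the bumped letter. *)
Fixpoint insert_row (x : nat) (row : seq nat) : seq nat * option nat :=
  if row is y :: row' then
    if x < y then (x :: row', Some y)
    else let: (row'', b) := insert_row x row' in (y :: row'', b)
  else ([:: x], None).

Fixpoint rsk_insert (P : filling) (x : nat) : filling :=
  if P is row :: P' then
    let: (row', b) := insert_row x row in
    if b is Some y then row' :: rsk_insert P' y else row' :: P'
  else [:: [:: x]].

Definition rsk_tableau (w : seq nat) : filling := foldl rsk_insert [::] w.

(* [i, i + 2m] is a Dyck pattern interval of T, where T has n cells. *)
Definition dyck_pattern_interval (n : nat) (T : filling) (i m : nat) : Prop :=
  [/\ 1 <= m,
      1 <= i /\ i + 2 * m <= n,
      shape (rsk_tableau (restrict (row_word T) i (i + 2 * m))) = [:: m.+1; m]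
    & shape (rsk_tableau (restrict (row_word T) i (i + m))) = [:: m.+1]].

(* Bracket matching by a left-to-right scan: letters satisfying [op] are open
   brackets, the others closed ones, and [d] counts the open brackets still
   unmatched.  Returns the letters of the unpaired closed brackets. *)
Fixpoint unpaired_closed (op : pred nat) (d : nat) (w : seq nat) : seq nat :=
  if w is x :: w' then
    if op x then unpaired_closed op d.+1 w'
    else if d is d'.+1 then unpaired_closed op d' w'
    else x :: unpaired_closed op 0 w'
  else [::].

(* For a Dyck pattern interval the list has exactly one element, so the default
   value of [head] plays no role. *)
Definition unpaired_letter (T : filling) (i m : nat) : nat :=
  head 0 (unpaired_closed (fun x => i + m < x) 0
            (restrict (row_word T) i (i + 2 * m))).

(* The cycle (m+k, m+k-1, ..., k). *)
Definition cycle_fun (m k x : nat) : nat :=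
  if x == k then k + m else if k < x <= k + m then x.-1 else x.

Definition act (f : nat -> nat) (T : filling) : filling :=
  [seq [seq f x | x <- row] | row <- T].

(* Puts x in the highest unoccupied cell of column c > 0 whose left neighbour
   contains a smaller entry (such a cell lies at the end of a row of length c). *)
Definition place (c : nat) (F : filling) (x : nat) : filling :=
  let rs := [seq r <- iota 0 (size F) |
              (size (nth [::] F r) == c) && (entry F r c.-1 < x)] in
  if rs is [::] then F
  else let r := last 0 rs in set_nth [::] F r (rcons (nth [::] F r) x).

(* The columns of a standard tableau increase from bottom to top, so [column]
   lists their entries from smallest to largest. *)
Definition phi_inv (T : filling) : filling :=
  foldl (fun F c => foldl (place c) F (column T c))
        [seq [:: x] | x <- column T 0]
        (iota 1 (size (head [::] T)).-1).

(* Main.v *)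
Require Import Defs.
From mathcomp Require Import all_boot zify.

(* Write a_t = i + t (t <= m) and b_s = i + m + s (1 <= s <= m), and let k = a_K.
   In the reading word b_s precedes a_(s-1) for s <= K, while for s > K it lies
   between a_K and a_s; hence b_s lies weakly left of a_(s-1), resp. of a_s.

   A column of phi^-1 is the unique stable matching between its letters and the
   rows, where rows prefer small letters and letters prefer high rows.  It only
   depends on the comparisons between letters of adjacent columns, and passing
   from T to T' can affect only two of them: a_K against a_(K+1) and b_K against
   a_K.  Changing the first one merely exchanges a_t and b_t in a run of columns,
   which keeps the shape.  Changing the second one matters only if a_(K-1) and
   b_K share the column before that of a_K, with b_K in the higher row.  Following
   the run of columns containing a_t and b_(t+1) back to its start, a_t is the
   higher one unless the run starts in column 0, which is condition (I).  In that
   case a_0, ..., a_K and b_1, ..., b_K start rows r0 and r0 + 1, and the change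
   exchanges the rest of these two rows until a column in which the upper row
   receives the smaller letter; so the shapes differ iff row r0 outlives row
   r0 + 1. *)

Set Implicit Arguments.
Unset Strict Implicit.
Unset Printing Implicit Defensive.

(** * Insertion tableaux and bracketed words *)

Variant insert_row_spec (x : nat) (R : seq nat) : seq nat * option nat -> Prop :=
| InsertAppend of all (leq^~ x) R : insert_row_spec x R (rcons R x, None)
| InsertBump R1 y R2 of R = R1 ++ y :: R2 & all (leq^~ x) R1 & x < y :
    insert_row_spec x R (R1 ++ x :: R2, Some y).

Lemma insert_rowP x R : insert_row_spec x R (insert_row x R).
Proof.
elim: R => [|y R IH] /=; first exact: InsertAppend.
case: ltnP => [lt_xy|le_yx]; first exact: (@InsertBump x _ [::] y R).
case: IH => [allR|R1 z R2 -> allR1 lt_xz].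
  by apply: (@InsertAppend x (y :: R)); rewrite /= le_yx.
by apply: (@InsertBump x _ (y :: R1) z R2) => //=; rewrite le_yx.
Qed.

Lemma size_rsk_insert P x : size P <= size (rsk_insert P x).
Proof.
elim: P x => [//|R P IH] x /=.
by case: (insert_rowP x R) => [_|R1 y R2 _ _ _] //=; apply: IH.
Qed.

Lemma size_foldl_rsk P w : size P <= size (foldl rsk_insert P w).
Proof.
elim: w P => [//|x w IH] P /=.
exact: leq_trans (size_rsk_insert P x) (IH _).
Qed.

Lemma sorted_leq_rcons s x : sorted leq s -> all (leq^~ x) s -> sorted leq (rcons s x).
Proof.
by rewrite !(sorted_pairwise leq_trans) pairwise_rcons => -> ->.
Qed.

(** A bump would open a second row, and the number of rows never decreases afterwards. *)
Lemma sorted_one_row w l : shape (rsk_tableau w) = [:: l] -> sorted leq w.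
Proof.
case: w => [//|x w].
rewrite -[rsk_tableau _]/(foldl rsk_insert [:: [:: x]] w) -[x :: w]cat1s.
have: sorted leq [:: x] by [].
elim: w [:: x] => [|y w IH] R R_sorted /=; first by rewrite cats0.
case: (insert_rowP y R) => [R_le|R1 z R2 _ _ _].
  by rewrite -cat_rcons; apply: IH; apply: sorted_leq_rcons.
move=> /(congr1 size); rewrite size_map /= => sz.
by have := size_foldl_rsk [:: R1 ++ y :: R2; [:: z]] w; rewrite sz.
Qed.

(** Tableaux built by [rsk_insert] have no empty row; dropping empty rows lets tableaux with zero,
    one or two rows share one form. *)
Definition two_rows (R1 R2 : seq nat) : filling := [seq R <- [:: R1; R2] | R != [::]].

(** The bound of two rows forces a letter bumped from the first row to land at the end of the
    second. *)
Lemma rsk_insert_two_rows R1 R2 x (P := rsk_insert (two_rows R1 R2) x) :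
  (R1 = [::] -> R2 = [::]) -> size P <= 2 ->
  (all (leq^~ x) R1 /\ P = two_rows (rcons R1 x) R2) \/
  (exists R1a y R1b, [/\ R1 = R1a ++ y :: R1b, all (leq^~ x) R1a, x < y,
     all (leq^~ y) R2 & P = two_rows (R1a ++ x :: R1b) (rcons R2 y)]).
Proof.
rewrite {}/P; have [->|R1n0] := eqVneq R1 [::].
  by move=> /(_ erefl) -> _; left.
move=> _; have -> : two_rows R1 R2 = R1 :: (if R2 == [::] then [::] else [:: R2]).
  by rewrite /two_rows /= R1n0; case: (R2).
have [->|R2n0] := eqVneq R2 [::]; rewrite [rsk_insert _ _]/=.
  case: (insert_rowP x R1) => [le_x _|R1a y R1b -> le_x lt_xy _].
    by left; split=> //; rewrite /two_rows /=; case: (R1).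
  by right; exists R1a, y, R1b; split=> //; case: (R1a).
case: (insert_rowP x R1) => [le_x _|R1a y R1b -> le_x lt_xy].
  by left; split=> //; rewrite /two_rows /= R2n0; case: (R1).
case: (insert_rowP y R2) => [le_y _|//].
right; exists R1a, y, R1b; split=> //; rewrite /two_rows /=.
by case: (R1a) => //=; case: (R2).
Qed.

Lemma size_foldl_rsk_cons P x w :
  size (rsk_insert P x) <= size (foldl rsk_insert P (x :: w)).
Proof. exact: size_foldl_rsk (rsk_insert P x) w. Qed.

Lemma cat_prefix_all (T : Type) (P : pred T) (C O Ra Rb : seq T) y :
  all P C -> ~~ P y -> C ++ O = Ra ++ y :: Rb ->
  exists2 Ra', Ra = C ++ Ra' & O = Ra' ++ y :: Rb.
Proof.
move=> allC Py; elim: C Ra allC => [|c C IH] [|r Ra] /=.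
- by exists [::].
- by exists (r :: Ra).
- by case/andP => Pc _ [eq_cy _]; rewrite -eq_cy Pc in Py.
- by case/andP => _ /IH{}IH [-> /IH[Ra' -> ->]]; exists Ra'.
Qed.

(* Letters at most p ("closed") are inserted in increasing order, so they stay
   in the first row; the final first row holds nothing else, so every open
   letter is bumped, and the second row only grows by appending. *)
Lemma rsk_open_sorted p w C O R2 l :
  all (leq^~ p) C -> all (fun x => p < x) O -> sorted leq (C ++ [seq x <- w | x <= p]) ->
  sorted leq O -> sorted leq R2 -> (C ++ O = [::] -> R2 = [::]) ->
  shape (foldl rsk_insert (two_rows (C ++ O) R2) w) =
    [:: size C + count (leq^~ p) w; l] ->
  sorted leq (R2 ++ O ++ [seq x <- w | p < x]) /\
  size (unpaired_closed (fun x => p < x) (size O) w) + size O + count (fun x => p < x) w =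
    count (leq^~ p) w.
Proof.
elim: w C O R2 => [|x w IH] C O R2 leC ltO sC sO sR2 nil_R.
  rewrite /= addn0.
  (* At the end the first row has length [size C], so [O] must be empty. *)
  case: O ltO sO nil_R => [|y O] ltO sO nil_R.
    by rewrite /= !cats0.
  have -> : two_rows (C ++ y :: O) R2 = (C ++ y :: O) :: [seq R <- [:: R2] | R != [::]].
    by rewrite /two_rows /=; case: (C).
  by case=> sz; exfalso; move: sz; rewrite size_cat /=; lia.
move=> sh_eq.
have szP : size (rsk_insert (two_rows (C ++ O) R2) x) <= 2.
  move/(congr1 size): sh_eq; rewrite size_map => sz.
  exact: leq_trans (size_foldl_rsk_cons _ x w) (eq_leq sz).
case: (rsk_insert_two_rows nil_R szP) => [[le_x eP]|].
  move: sh_eq; rewrite [foldl _ _ (_ :: _)]/= eP /=; case: (leqP x p) => le_xp.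
    have O0 : O = [::].
      case: O ltO le_x {sO nil_R szP eP} => [//|y O] /andP[lt_py _].
      by rewrite all_cat /= => /and3P[_ ? _]; lia.
    subst O; rewrite cats0 => sh_eq.
    case: (IH (rcons C x) [::] R2) => //=.
    - by rewrite all_rcons le_xp.
    - by rewrite cat_rcons; move: sC; rewrite /= le_xp.
    - by rewrite cats0; case: (C).
    - by rewrite cats0 sh_eq size_rcons; congr [:: _; _]; lia.
    by move=> ? ?; split=> //; lia.
  rewrite add0n -cats1 -catA cats1 => sh_eq.
  case: (IH C (rcons O x) R2) => //.
  - by rewrite all_rcons /= le_xp.
  - by move: sC; rewrite /= leqNgt le_xp.
  - apply: sorted_leq_rcons => //.
    by move: le_x; rewrite all_cat => /andP[].
  - by case: (C) => //; case: (O).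
  by rewrite cat_rcons size_rcons; move=> ? ?; split=> //; lia.
case=> [Ra [y [Rb [eCO le_x lt_xy le_y eP]]]].
move: sh_eq; rewrite [foldl _ _ (_ :: _)]/= eP /=; case: (leqP x p) => le_xp sh_eq.
  have CltX : all (leq^~ x) C.
    move: sC; rewrite /= le_xp (sorted_pairwise leq_trans) pairwise_cat.
    by case/and3P => + _ _; rewrite allrel_consr => /andP[].
  have [|Ra' eRa eO] := cat_prefix_all CltX _ eCO; first by lia.
  (* A closed letter bumps the first open one, since all open letters exceed it. *)
  have eRa' : Ra' = [::].
    case: Ra' eRa eO => [//|z Ra'] eRa eO; move: le_x ltO.
    by rewrite eRa eO all_cat /= => /and3P[_ ? _] /andP[]; lia.
  rewrite {}eRa' /= ?cats0 in eRa eO; rewrite {}eO {}eRa in sO ltO sh_eq *.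
  case: (IH (rcons C x) Rb (rcons R2 y)) => //.
  - by rewrite all_rcons le_xp.
  - by move: ltO => /andP[].
  - by rewrite cat_rcons; move: sC; rewrite /= le_xp.
  - exact: path_sorted sO.
  - exact: sorted_leq_rcons.
  - by case: (C).
  - by rewrite cat_rcons sh_eq size_rcons; congr [:: _; _]; lia.
  by rewrite cat_rcons /=; move=> ? ?; split=> //; lia.
have [|Ra' eRa eO] := cat_prefix_all leC _ eCO; first by lia.
(* An open letter cannot bump another: the bumped [y] would precede [x < y] in the list that the
   induction hypothesis shows to be sorted. *)
exfalso; move: le_x; rewrite eRa all_cat => /andP[_ le_x].
have sO' : sorted leq (Ra' ++ x :: Rb).
  move: sO; rewrite eO !(sorted_pairwise leq_trans) !pairwise_cat /= !allrel_consr.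
  case/and3P => /andP[_ ->] -> /andP[le_yRb ->]; rewrite le_x /= andbT.
  by apply: sub_all le_yRb => z; lia.
case: (IH C (Ra' ++ x :: Rb) (rcons R2 y)) => //.
- move: ltO; rewrite eO !all_cat /= => /and3P[-> _ ->]; lia.
- by move: sC; rewrite /= leqNgt le_xp.
- exact: sorted_leq_rcons.
- by case: (C) => //; case: (Ra').
- by rewrite catA -eRa sh_eq.
rewrite cat_rcons (sorted_pairwise leq_trans) pairwise_cat /= => /and3P[_ _ /andP[+ _]] _.
by rewrite !all_cat /= => /andP[/and3P[_ ? _] _]; lia.
Qed.

(** The letters satisfying [P] occur in the order a, a + 1, ..., so a prefix holds an initial run of
    them and membership becomes a count. *)
Lemma mem_take_filter_iota (P : pred nat) w a l j t :
  [seq x <- w | P x] = iota a l -> t < l ->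
  (a + t \in take j w) = (t < count P (take j w)).
Proof.
move=> ew lt_tl.
have Pat : P (a + t).
  have: a + t \in [seq x <- w | P x] by rewrite ew mem_iota; lia.
  by rewrite mem_filter => /andP[].
have eq_take : [seq x <- take j w | P x] = take (count P (take j w)) (iota a l).
  by rewrite -ew -{3}(cat_take_drop j w) filter_cat take_size_cat ?size_filter.
transitivity (a + t \in [seq x <- take j w | P x]); first by rewrite mem_filter Pat.
rewrite eq_take take_iota mem_iota; lia.
Qed.

(** * Unpaired brackets and the order of the letters *)

Lemma count_unpaired_nil op d w j :
  unpaired_closed op d w = [::] ->
  count (predC op) (take j w) <= d + count op (take j w).
Proof.
elim: w d j => [//|x w IH] d [|j] //=.
case: (op x) => /=; first by move/(IH d.+1 j); lia.
by case: d => [//|d] /(IH d j); lia.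
Qed.

(** No open bracket is pending at the first unpaired closed one, so [u] uses up its own open
    brackets and the [d] pending at the start, and no prefix of [u] uses more than are available. *)
Lemma unpaired_consP op d w k r :
  unpaired_closed op d w = k :: r ->
  exists u v, [/\ w = u ++ k :: v, ~~ op k, unpaired_closed op 0 v = r,
    count (predC op) u = d + count op u &
    forall j, count (predC op) (take j u) <= d + count op (take j u)].
Proof.
elim: w d => [//|x w IH] d /=; case opx: (op x) => unp.
  have := IH _ unp; case=> u [v [-> nopk eqr eqc le_c]]; exists (x :: u), v; split=> //=.
    by rewrite opx /=; lia.
  by case=> [|j] //=; rewrite opx /=; have := le_c j; lia.
case: d unp => [[<- eqr]|d unp].
  by exists [::], w; split=> //; rewrite opx.
have := IH _ unp; case=> u [v [-> nopk eqr eqc le_c]]; exists (x :: u), v; split=> //=.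
  by rewrite opx /=; lia.
by case=> [|j] //=; rewrite opx /=; have := le_c j; lia.
Qed.

(* The closed letters are i, ..., i + m and the open ones i + m + 1, ...,
   i + 2m; the unpaired letter is i + K. *)
Definition dyck_order (bef : rel nat) (i m K : nat) : Prop :=
  [/\ forall s t, s < t <= m -> bef (i + s) (i + t),
      forall s t, 0 < s < t -> t <= m -> bef (i + m + s) (i + m + t),
      forall s, 0 < s <= K -> bef (i + m + s) (i + s.-1) &
      forall s, K < s <= m -> bef (i + K) (i + m + s) && bef (i + m + s) (i + s)].

(** Closed letters and open letters each occur in increasing order, so relative positions reduce to
    counts in prefixes. Prefixes ending before the unpaired letter have at most as many closed as
    open letters, longer ones at most one more. [K] is the number of closed letters before the
    unpaired one. *)
Lemma dyck_word_order i m w (k := head 0 (unpaired_closed (fun x => i + m < x) 0 w)) :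
  perm_eq w (iota i (2 * m).+1) ->
  shape (rsk_tableau w) = [:: m.+1; m] ->
  shape (rsk_tableau [seq x <- w | x <= i + m]) = [:: m.+1] ->
  exists2 K, K <= m & k = i + K /\
    dyck_order (fun x y => index x w < index y w) i m K.
Proof.
rewrite {}/k; set p := i + m => perm_w sh_w sh_c.
have uniq_w : uniq w by rewrite (perm_uniq perm_w) iota_uniq.
have mem_w x : (x \in w) = (i <= x < i + (2 * m).+1) by rewrite (perm_mem perm_w) mem_iota.
have sorted_c := sorted_one_row sh_c.
have perm_c : perm_eq [seq x <- w | x <= p] (iota i m.+1).
  rewrite uniq_perm ?filter_uniq ?iota_uniq // => x.
  by rewrite mem_filter mem_w mem_iota; lia.
have perm_o : perm_eq [seq x <- w | p < x] (iota p.+1 m).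
  rewrite uniq_perm ?filter_uniq ?iota_uniq // => x.
  by rewrite mem_filter mem_w mem_iota; lia.
have eq_c : [seq x <- w | x <= p] = iota i m.+1.
  exact: (sorted_eq leq_trans anti_leq sorted_c (iota_sorted _ _)).
have cnt_c : count (leq^~ p) w = m.+1 by rewrite -size_filter eq_c size_iota.
have cnt_o : count (fun x => p < x) w = m by rewrite -size_filter (perm_size perm_o) size_iota.
have [|sorted_o size_u] :=
  @rsk_open_sorted p w [::] [::] [::] m isT isT sorted_c isT isT (fun=> erefl).
  by rewrite cnt_c.
have eq_o : [seq x <- w | p < x] = iota p.+1 m.
  exact: (sorted_eq leq_trans anti_leq sorted_o (iota_sorted _ _)).
rewrite /= cnt_c cnt_o in size_u.
(* By the count of m + 1 closed and m open letters, the list has exactly one element. *)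
case eq_u: (unpaired_closed _ 0 w) size_u => [|k [|? ?]] //= size_u; try lia.
have [u [v [ew nopk /count_unpaired_nil unp_v cnt_u unp_u]]] := unpaired_consP eq_u.
have eqC s : count (predC (fun x => p < x)) s = count (leq^~ p) s.
  by apply: eq_count => x /=; rewrite -leqNgt.
set K := count (leq^~ p) u.
have cnt_uo : count (fun x => p < x) u = K by rewrite /K -eqC cnt_u.
have szu : index k w = size u.
  move: uniq_w; rewrite ew cat_uniq => /and3P[_ /hasPn/(_ k (mem_head _ _)) ku _].
  by rewrite index_cat (negbTE ku) /= eqxx addn0.
have eq_k : k = i + K.
  move/(congr1 (nth 0 ^~ K)): eq_c; rewrite ew filter_cat.
  have -> : [seq x <- k :: v | x <= p] = k :: [seq x <- v | x <= p].
    by rewrite /= (leqNgt k p) nopk.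
  rewrite nth_cat size_filter ltnn subnn [nth _ (k :: _) 0]/= => ->; rewrite nth_iota //.
  by rewrite -cnt_c ew count_cat /= (leqNgt k p) nopk /K; lia.
have K_le : K <= m.
  by have : k \in w; [rewrite ew mem_cat mem_head orbT | rewrite mem_w; lia].
have mem_tc j t : t <= m -> (i + t \in take j w) = (t < count (leq^~ p) (take j w)).
  by move=> le_tm; apply: mem_take_filter_iota eq_c _.
have mem_to j s : 0 < s <= m ->
  (p + s \in take j w) = (s.-1 < count (fun x => p < x) (take j w)).
  move=> s_bound; have -> : p + s = p.+1 + s.-1 by lia.
  by apply: mem_take_filter_iota eq_o _; lia.
have idx j x : x \in w -> (x \in take j w) = (index x w < j) by move=> xw; rewrite in_take.
have idx_c j t : t <= m -> (index (i + t) w < j) = (t < count (leq^~ p) (take j w)).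
  by move=> ?; rewrite -idx ?mem_tc // mem_w; lia.
have idx_o j s : 0 < s <= m ->
  (index (p + s) w < j) = (s.-1 < count (fun x => p < x) (take j w)).
  by move=> ?; rewrite -idx ?mem_to // mem_w; lia.
have idx_neq x y : x \in w -> x != y -> index x w != index y w.
  move=> xw; apply: contra => /eqP eq_xy.
  have yw : y \in w by rewrite -index_mem -eq_xy index_mem.
  by rewrite -(nth_index 0 xw) eq_xy nth_index.
have low j : j <= size u -> count (leq^~ p) (take j w) <= count (fun x => p < x) (take j w).
  by move=> le_j; rewrite ew takel_cat // -eqC; apply: unp_u.
have high j : size u < j ->
    count (leq^~ p) (take j w) <= (count (fun x => p < x) (take j w)).+1.
  move=> lt_j; have -> : take j w = u ++ k :: take (j - size u).-1 v.
    rewrite ew take_cat ltnNge ltnW //=; congr (_ ++ _).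
    by case: (j - size u) (subn_gt0 (size u) j) => //; rewrite lt_j.
  rewrite !count_cat /= -/K cnt_uo (negbTE nopk) (leqNgt k p) nopk.
  by have := unp_v (j - size u).-1; rewrite eqC; lia.
exists K => //; split=> //; rewrite /dyck_order -/p; split.
- move=> s t /andP[lt_st le_tm].
  rewrite ltn_neqAle idx_neq ?mem_w; try lia.
  rewrite -ltnS idx_c; last lia.
  by have := idx_c (index (i + t) w).+1 t le_tm; lia.
- move=> s t st le_tm; rewrite ltn_neqAle idx_neq ?mem_w; try lia.
  rewrite -ltnS idx_o; last lia.
  by have := idx_o (index (p + t) w).+1 t ltac:(lia); lia.
(* The prefix ending with a_(s-1) stops before the unpaired letter and has s closed letters, hence
   at least s open ones. *)
- move=> s s_bound; rewrite ltn_neqAle idx_neq ?mem_w; try lia.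
  rewrite -ltnS idx_o; last lia.
  have := idx_c (size u) s.-1 ltac:(lia); rewrite ew take_size_cat // -ew -/K => lt_u.
  have := idx_c (index (i + s.-1) w).+1 s.-1 ltac:(lia).
  by have := low (index (i + s.-1) w).+1 ltac:(lia); lia.
- move=> s s_bound; apply/andP; split.
    rewrite -eq_k szu ltn_neqAle -szu eq_k idx_neq ?mem_w -?eq_k ?szu; try lia.
    rewrite leqNgt idx_o; last lia.
    by rewrite ew take_size_cat // cnt_uo; lia.
  (* The prefix ending with a_s has s + 1 closed letters, hence at least s open ones. *)
  have := idx_c (size u) s ltac:(lia); rewrite ew take_size_cat // -ew -/K => lt_u.
  rewrite ltn_neqAle idx_neq ?mem_w; try lia.
  rewrite -ltnS idx_o; last lia.
  have := idx_c (index (i + s) w).+1 s ltac:(lia).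
  by have := high (index (i + s) w).+1 ltac:(lia); lia.
Qed.

(** * Coordinates in standard tableaux *)

Definition row_of (T : filling) x := reshape_index (shape T) (index x (flatten T)).
Definition col_of (T : filling) x := reshape_offset (shape T) (index x (flatten T)).

Definition reads_before (T : filling) : rel nat := fun x y =>
  (row_of T y < row_of T x) || (row_of T x == row_of T y) && (col_of T x < col_of T y).

Lemma entry_row_col T x (xT : x \in flatten T) :
  col_of T x < size (nth [::] T (row_of T x)) /\ entry T (row_of T x) (col_of T x) = x.
Proof.
split; last by rewrite /entry -nth_flatten nth_index.
by rewrite -nth_shape; apply: reshape_offsetP; rewrite -size_flatten index_mem.
Qed.

Lemma mem_flatten_entry T r c : c < size (nth [::] T r) -> entry T r c \in flatten T.
Proof.
move=> lt_c; apply/flattenP; exists (nth [::] T r); last exact: mem_nth.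
by apply: mem_nth; have [//|le_r] := ltnP r (size T); rewrite nth_default in lt_c.
Qed.

Lemma row_col_entry T r c :
  uniq (flatten T) -> c < size (nth [::] T r) ->
  row_of T (entry T r c) = r /\ col_of T (entry T r c) = c.
Proof.
move=> uniqT; rewrite -nth_shape => lt_c.
have -> : entry T r c = nth 0 (flatten T) (flatten_index (shape T) r c).
  by rewrite nth_flatten flatten_indexKl // flatten_indexKr.
have lt_i : flatten_index (shape T) r c < size (flatten T).
  by rewrite size_flatten flatten_indexP.
by rewrite /row_of /col_of index_uniq // flatten_indexKl // flatten_indexKr.
Qed.

Lemma mem_columnP T e x :
  reflect (exists2 r, e < size (nth [::] T r) & entry T r e = x) (x \in column T e).
Proof.
apply: (iffP mapP) => [[s]|[r lt_e <-]].
  rewrite mem_filter => /andP[lt_e sT] ->; exists (index s T); rewrite /entry nth_index //.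
exists (nth [::] T r) => //; rewrite mem_filter lt_e /=.
by apply: mem_nth; have [//|le_r] := ltnP r (size T); rewrite nth_default in lt_e.
Qed.

Lemma mem_column T e x : uniq (flatten T) ->
  (x \in column T e) = (x \in flatten T) && (col_of T x == e).
Proof.
move=> uniqT; apply/mem_columnP/andP => [[r lt_e <-]|[xT /eqP <-]].
  by have [_ ->] := row_col_entry uniqT lt_e; rewrite mem_flatten_entry.
by have [? ?] := entry_row_col xT; exists (row_of T x).
Qed.

Lemma pairwise_flatten (S : eqType) (R : rel S) ss :
  pairwise (allrel R) ss -> all (pairwise R) ss -> pairwise R (flatten ss).
Proof.
elim: ss => [//|s ss IH] /= /andP[all_s /IH{}IH] /andP[pw_s /IH{}IH].
rewrite pairwise_cat pw_s IH andbT andbT.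
apply/allrelP => x y xs /flattenP[t /(allP all_s)/allrelP sub yt].
exact: sub.
Qed.

Lemma pairwise_row_word T : uniq (flatten T) -> pairwise (reads_before T) (row_word T).
Proof.
move=> uniqT.
have pos r x : x \in nth [::] T r -> exists2 c, c < size (nth [::] T r) & x = entry T r c.
  by move=> xr; exists (index x (nth [::] T r)); rewrite ?index_mem // /entry nth_index.
apply: pairwise_flatten.
  apply/(pairwiseP [::]) => j j'; rewrite !inE size_rev => lt_j lt_j' lt_jj'.
  rewrite !nth_rev //; apply/allrelP => x y /pos[c lt_c ->] /pos[c' lt_c' ->].
  rewrite /reads_before; have [-> _] := row_col_entry uniqT lt_c.
  by have [-> _] := row_col_entry uniqT lt_c'; lia.
apply/allP => s; rewrite mem_rev => /(nthP [::])[r lt_r <-].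
apply/(pairwiseP 0) => c c'; rewrite !inE => lt_c lt_c' lt_cc'.
rewrite /reads_before; have [-> ->] := row_col_entry uniqT lt_c.
by have [-> ->] := row_col_entry uniqT lt_c'; rewrite eqxx lt_cc' orbT.
Qed.

Lemma pairwise_index (S : eqType) (R : rel S) s x y :
  pairwise R s -> y \in s -> index x s < index y s -> R x y.
Proof.
case: s => [//|z s]; set s' := z :: s => pw ys lt_xy.
have lt_y : index y s' < size s' by rewrite index_mem.
have xs : x \in s' by rewrite -index_mem (ltn_trans lt_xy).
rewrite -(nth_index z xs) -(nth_index z ys).
by apply: (pairwiseP z pw) => //; rewrite inE ?index_mem.
Qed.

Section StandardTableaux.

Variables (n : nat) (la : seq nat) (T : filling).
Hypotheses (la_part : is_partition la n) (T_syt : is_SYT la T).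

Lemma SYT_row_size r : size (nth [::] T r) = nth 0 la r.
Proof. by case: T_syt => <- _ _ _; rewrite nth_shape. Qed.

Lemma partition_nth r r' : r <= r' -> nth 0 la r' <= nth 0 la r.
Proof.
move=> le_r; have [lt_r'|ge_r'] := ltnP r' (size la); last by rewrite nth_default.
case/and3P: la_part => la_sorted _ _.
have geq_trans : transitive geq by move=> x y z; rewrite /geq /=; lia.
apply: (sorted_leq_nth geq_trans _ 0 la_sorted) => //; rewrite ?inE //.
  by move=> x; rewrite /geq /=.
exact: leq_ltn_trans lt_r'.
Qed.

Lemma mem_SYT x : (x \in flatten T) = (0 < x <= n).
Proof.
case: T_syt => _ perm_T _ _; case/and3P: la_part => _ _ /eqP sum_la.
by rewrite (perm_mem perm_T) sum_la mem_iota; lia.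
Qed.

Lemma uniq_SYT : uniq (flatten T).
Proof. by case: T_syt => _ perm_T _ _; rewrite (perm_uniq perm_T) iota_uniq. Qed.

Lemma entry_row_le r c c' : c <= c' -> c' < nth 0 la r -> entry T r c <= entry T r c'.
Proof.
case: T_syt => _ _ row_incr _ /subnKC <-; elim: (c' - c) => [|d IH]; first by rewrite addn0.
rewrite addnS => lt_d; apply: leq_trans (IH (ltnW lt_d)) (ltnW _).
exact: row_incr.
Qed.

Lemma entry_col_lt r r' c : r < r' -> c < nth 0 la r' -> entry T r c < entry T r' c.
Proof.
case: T_syt => _ _ _ col_incr /subnKC <-; elim: (r' - r.+1) => [|d IH].
  by rewrite addn0; apply: col_incr.
rewrite addnS => lt_c; have := partition_nth (leqnSn (r.+1 + d)).
by move/(leq_trans lt_c)/IH => /ltn_trans -> //; apply: col_incr.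
Qed.

Lemma entry_le r r' c c' : r <= r' -> c <= c' -> c' < nth 0 la r' ->
  entry T r c <= entry T r' c'.
Proof.
rewrite leq_eqVlt => /predU1P[->|lt_r] le_c lt_c'; first exact: entry_row_le.
apply: leq_trans (ltnW (entry_col_lt lt_r (leq_ltn_trans le_c lt_c'))) _.
exact: entry_row_le.
Qed.

Lemma mem_SYT_column e x : (x \in column T e) = (0 < x <= n) && (col_of T x == e).
Proof. by rewrite mem_column ?uniq_SYT // mem_SYT. Qed.

Lemma column_SYT e :
  column T e = [seq entry T r e | r <- iota 0 (size T) & e < nth 0 la r].
Proof.
rewrite /column -{1}(mkseq_nth [::] T) /mkseq filter_map -map_comp.
by congr (map _ _); apply: eq_filter => r /=; rewrite SYT_row_size.
Qed.

Lemma sorted_SYT_column e : sorted ltn (column T e).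
Proof.
rewrite column_SYT.
apply: (@homo_sorted_in _ _ [pred r | e < nth 0 la r] _ ltn).
- by move=> r r' _ lt_e lt_r; apply: entry_col_lt.
- exact: filter_all.
- apply: sorted_filter; [exact: ltn_trans | exact: iota_ltn_sorted].
Qed.

Lemma nth_SYT_column0 r : nth 0 (column T 0) r = entry T r 0.
Proof.
have -> : column T 0 = [seq nth 0 s 0 | s <- T].
  congr (map _ _); apply/all_filterP/allP => s /(nthP [::])[j lt_j <-].
  rewrite SYT_row_size lt0n; case/and3P: la_part => _ + _; apply: contraNN => /eqP <-.
  by apply: mem_nth; case: T_syt => <- _ _ _; rewrite size_map.
have [lt_r|ge_r] := ltnP r (size T); first by rewrite (nth_map [::]).
by rewrite /entry !(nth_default, size_map).
Qed.

Lemma SYT_column_nil e : size (head [::] T) <= e -> column T e = [::].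
Proof.
rewrite -nth0 SYT_row_size => le_e; rewrite column_SYT.
rewrite (eq_filter (a2 := pred0)) ?filter_pred0 // => r /=.
by have := partition_nth (leq0n r); lia.
Qed.

Section ReadsBefore.

Variables x y : nat.
Hypotheses (x_mem : 0 < x <= n) (y_mem : 0 < y <= n) (xy : reads_before T x y).

(** Were x not strictly to the left, it would lie in a higher row and weakly to the right of y,
    hence be larger. *)
Lemma reads_before_col : x < y -> col_of T x < col_of T y.
Proof.
have [lt_x eq_x] := entry_row_col (etrans (mem_SYT x) x_mem).
have [lt_y eq_y] := entry_row_col (etrans (mem_SYT y) y_mem).
move=> lt_xy; case/orP: xy => [lt_r|/andP[]//].
rewrite ltnNge; apply/negP => le_c.
rewrite SYT_row_size in lt_x.
by have := entry_le (ltnW lt_r) le_c lt_x; rewrite eq_x eq_y; lia.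
Qed.

Lemma reads_before_row : y < x -> row_of T y < row_of T x.
Proof.
have [lt_x eq_x] := entry_row_col (etrans (mem_SYT x) x_mem).
have [lt_y eq_y] := entry_row_col (etrans (mem_SYT y) y_mem).
move=> lt_yx; case/orP: xy => [//|/andP[/eqP eq_r lt_c]].
rewrite SYT_row_size in lt_y.
by have := entry_row_le (ltnW lt_c) lt_y; rewrite -{1}eq_r eq_x eq_y; lia.
Qed.

End ReadsBefore.

(* z is the entry in the row of x and the column of y. *)
Lemma cross_entry x y : 0 < x <= n -> 0 < y <= n ->
  row_of T y < row_of T x -> col_of T y < col_of T x ->
  exists z, [/\ 0 < z <= n, y < z < x, col_of T z = col_of T y & ~~ reads_before T y z].
Proof.
move=> x_mem y_mem lt_r lt_c.
have [lt_x eq_x] := entry_row_col (etrans (mem_SYT x) x_mem).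
have [lt_y eq_y] := entry_row_col (etrans (mem_SYT y) y_mem).
have lt_z : col_of T y < size (nth [::] T (row_of T x)) by exact: ltn_trans lt_x.
have [eq_r eq_c] := row_col_entry uniq_SYT lt_z.
exists (entry T (row_of T x) (col_of T y)); split=> //.
- by rewrite -mem_SYT mem_flatten_entry.
- rewrite SYT_row_size in lt_z lt_x.
  rewrite -{1}eq_y entry_col_lt //= -{2}eq_x; case: T_syt => _ _ row_incr _.
  apply: leq_trans (row_incr _ _ _) _; first exact: leq_ltn_trans lt_x.
  exact: entry_row_le.
- by rewrite /reads_before eq_r eq_c; lia.
Qed.

End StandardTableaux.

(* In terms of the letters a_t = i + t and b_s = i + m + s. *)
Definition dyck_columns (col : nat -> nat) (i m K : nat) : Prop :=
  [/\ forall s t, s < t <= m -> col (i + s) < col (i + t),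
      forall s t, 0 < s < t -> t <= m -> col (i + m + s) < col (i + m + t),
      forall s, 0 < s <= K -> col (i + m + s) <= col (i + s.-1) &
      forall s, K < s <= m -> col (i + K) < col (i + m + s) <= col (i + s)].

(** A letter read earlier and larger lies in a higher row. If b_s were to the right of a_(s-1), the
    row of b_s and the column of a_(s-1) would meet in a letter z between the two in value and not
    read after a_(s-1). So z is no a_u; it is b_u with u < s, which by induction lies further left.
    The bound by a_s for s > K is obtained in the same way. *)
Lemma dyck_order_columns n la T i m K :
  is_partition la n -> is_SYT la T -> 0 < i -> i + 2 * m <= n -> K <= m ->
  dyck_order (reads_before T) i m K -> dyck_columns (col_of T) i m K.
Proof.
move=> la_part T_syt i_gt0 le_n le_K [bef_a bef_b bef_low bef_high].
have col_a s t : s < t <= m -> col_of T (i + s) < col_of T (i + t).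
  by move=> st; apply: (reads_before_col la_part T_syt) (bef_a _ _ st) _; lia.
have col_low s : 0 < s <= K -> col_of T (i + m + s) <= col_of T (i + s.-1).
  elim/ltn_ind: s => s IH sK; rewrite leqNgt; apply/negP => lt_c.
  have lt_r : row_of T (i + s.-1) < row_of T (i + m + s).
    by apply: (reads_before_row la_part T_syt) (bef_low _ sK) _; lia.
  have [||z [z_mem z_btw eq_c nbef]] := cross_entry la_part T_syt _ _ lt_r lt_c; try lia.
  have [le_z|gt_z] := leqP z (i + m).
    move: nbef; have -> : z = i + (z - i) by lia.
    by rewrite bef_a //; lia.
  have ez : z = i + m + (z - (i + m)) by lia.
  have := IH (z - (i + m)) ltac:(lia) ltac:(lia); rewrite -ez eq_c.
  by have := col_a (z - (i + m)).-1 s.-1 ltac:(lia); lia.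
split=> //.
  by move=> s t st le_t; apply: (reads_before_col la_part T_syt) (bef_b _ _ st le_t) _; lia.
move=> s; elim/ltn_ind: s => s IH sK; have /andP[bef1 bef2] := bef_high _ sK.
apply/andP; split; first by apply: (reads_before_col la_part T_syt) bef1 _; lia.
rewrite leqNgt; apply/negP => lt_c.
have lt_r : row_of T (i + s) < row_of T (i + m + s).
  by apply: (reads_before_row la_part T_syt) bef2 _; lia.
have [||z [z_mem z_btw eq_c nbef]] := cross_entry la_part T_syt _ _ lt_r lt_c; try lia.
have [le_z|gt_z] := leqP z (i + m).
  move: nbef; have -> : z = i + (z - i) by lia.
  by rewrite bef_a //; lia.
have ez : z = i + m + (z - (i + m)) by lia.
have [le_K'|gt_K] := leqP (z - (i + m)) K.
  have := col_low (z - (i + m)) ltac:(lia); rewrite -ez eq_c.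
  by have := col_a (z - (i + m)).-1 s ltac:(lia); lia.
have := IH (z - (i + m)) ltac:(lia) ltac:(lia); rewrite -ez eq_c.
by have := col_a (z - (i + m)) s ltac:(lia); lia.
Qed.

Lemma dyck_pattern_columns n la T i m :
  is_partition la n -> is_SYT la T -> dyck_pattern_interval n T i m ->
  exists2 K, K <= m & unpaired_letter T i m = i + K /\ dyck_columns (col_of T) i m K.
Proof.
move=> la_part T_syt [m_gt0 [i_gt0 le_n] sh_I sh_C].
have uniqT := uniq_SYT T_syt.
have pw := pairwise_row_word uniqT.
set w := restrict (row_word T) i (i + 2 * m).
have mem_w x : (x \in w) = (i <= x <= i + 2 * m).
  have memT : (x \in row_word T) = (0 < x <= n).
    rewrite -(mem_SYT la_part T_syt); apply/flattenP/flattenP => -[s sT xs];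
      by exists s; rewrite ?mem_rev // -mem_rev.
  by rewrite mem_filter memT; lia.
have pw_w : pairwise (reads_before T) w by exact: pairwise_filter.
have perm_w : perm_eq w (iota i (2 * m).+1).
  rewrite uniq_perm ?iota_uniq //; last by move=> x; rewrite mem_w mem_iota; lia.
  by apply: pairwise_uniq pw_w => x; rewrite /reads_before !ltnn andbF.
have [|K le_K [eq_k [bef_a bef_b bef_low bef_high]]] := dyck_word_order perm_w sh_I.
  rewrite -sh_C; congr (shape (rsk_tableau _)).
  by rewrite /w /restrict -filter_predI; apply: eq_filter => x /=; lia.
exists K => //; split=> //; apply: dyck_order_columns la_part T_syt _ _ _ _ => //.
have bef x y : i <= y <= i + 2 * m -> index x w < index y w -> reads_before T x y.
  by move=> y_mem; apply: pairwise_index pw_w _; rewrite mem_w.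
split=> [s t st|s t st le_t|s sK|s sK].
- by apply: bef (bef_a _ _ st); lia.
- by apply: bef (bef_b _ _ st le_t); lia.
- by apply: bef (bef_low _ sK); lia.
- by case/andP: (bef_high _ sK) => bef1 bef2; rewrite !bef //; lia.
Qed.

(** * Stable columns *)

(* A r x says that row r may receive the letter x.  A column w (0 marks an empty
   row) is stable if no row r and letter x would both improve by being matched:
   rows prefer small letters, letters prefer high rows.  Filling a column from
   the smallest letter to the largest yields the unique stable column. *)
Definition stable (A : nat -> nat -> bool) (s : seq nat) (w : nat -> nat) : Prop :=
  [/\ forall r, w r != 0 -> (w r \in s) && A r (w r),
      forall r r', w r != 0 -> w r = w r' -> r = r' &
      forall r x, x \in s -> A r x -> 0 < w r <= x \/ exists2 r', r < r' & w r' = x].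

Definition avail (R : rel nat) (v : nat -> nat) (r x : nat) : bool :=
  (v r != 0) && R (v r) x.

Lemma stable_ext A A' s w w' :
  (forall r x, x \in s -> A r x = A' r x) -> w =1 w' -> stable A s w -> stable A' s w'.
Proof.
move=> eqA eqw [mem inj opt]; split=> [r|r r'|r x xs].
- by rewrite -!eqw => /mem/andP[ws wA]; rewrite ws -eqA.
- by rewrite -!eqw; apply: inj.
- rewrite -eqA // -eqw => /(opt _ _ xs)[?|[r' ? ?]]; [by left | right].
  by exists r' => //; rewrite -eqw.
Qed.

(** Strong induction on the letter x. If row r holds x in one column only, then, smaller letters
    agreeing, stability of the other column puts x in a higher row r' there. Stability of the first
    column at r' then yields a second copy of x or a smaller letter in r', both impossible. *)
Lemma stable_unique A s w w' : 0 \notin s -> stable A s w -> stable A s w' -> w =1 w'.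
Proof.
move=> s0; suff agree w1 w2 x : stable A s w1 -> stable A s w2 ->
    (forall y r, y < x -> w1 r = y -> y != 0 -> w2 r = y) ->
    (forall y r, y < x -> w2 r = y -> y != 0 -> w1 r = y) ->
    forall r, w1 r = x -> x != 0 -> w2 r = x.
  move=> st st'.
  have both x : (forall r, w r = x -> x != 0 -> w' r = x) /\
                (forall r, w' r = x -> x != 0 -> w r = x).
    elim/ltn_ind: x => x IH.
    by split; apply: agree => // y r lt_y; case: (IH y lt_y); auto.
  move=> r; have [w0|wn0] := eqVneq (w r) 0; last by rewrite (proj1 (both (w r)) r).
  by have [-> //|wn0'] := eqVneq (w' r) 0; rewrite (proj2 (both (w' r)) r).
move=> [mem inj opt] [mem' inj' opt'] IH12 IH21 r eq_x x_n0.
have /andP[xs Ax] : (x \in s) && A r x by rewrite -eq_x mem // eq_x.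
case: (opt' _ _ xs Ax) => [|[r' lt_r eq_x']].
  move=> /andP[w2_gt0]; rewrite leq_eqVlt => /predU1P[//|lt_x].
  by have := IH21 _ _ lt_x erefl; rewrite eq_x -lt0n w2_gt0 => /(_ isT) eqx; lia.
have /andP[_ Ax'] : (x \in s) && A r' x by rewrite -eq_x' mem' // eq_x'.
case: (opt _ _ xs Ax') => [|[r'' lt_r' eq_x'']].
  move=> /andP[w1_gt0]; rewrite leq_eqVlt => /predU1P[eq_r'|lt_x].
    by have := inj r r' _ _; rewrite eq_x eq_r' => /(_ x_n0 erefl); lia.
  by have := IH12 _ _ lt_x erefl; rewrite eq_x' -lt0n w1_gt0 => /(_ isT) eqx; lia.
by have := inj r r'' _ _; rewrite eq_x eq_x'' => /(_ x_n0 erefl); lia.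
Qed.

(** * Greedy filling of one column *)

Lemma stable_nil A : stable A [::] (fun=> 0).
Proof. by []. Qed.

Lemma stable_skip A s w x : stable A s w -> all (ltn^~ x) s ->
  (forall r, A r x -> w r != 0) -> stable A (rcons s x) w.
Proof.
move=> [mem inj opt] /allP lt_x full; split=> // [r wr|r y].
  by have /andP[ws ->] := mem _ wr; rewrite mem_rcons inE ws orbT.
rewrite mem_rcons inE => /predU1P[-> /full wr|]; last exact: opt.
by left; rewrite lt0n wr; have /andP[/lt_x /ltnW] := mem _ wr.
Qed.

(** As x exceeds all letters placed so far, no occupied row would rather have it, and q is the
    highest free row that admits it. *)
Lemma stable_put A s w x q w' : 0 \notin s -> stable A s w -> all (ltn^~ x) s -> x != 0 ->
  A q x -> w q = 0 -> (forall r, q < r -> A r x -> w r != 0) ->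
  (forall r, w' r = if r == q then x else w r) -> stable A (rcons s x) w'.
Proof.
move=> s0 [mem inj opt] /allP lt_x x_n0 Aq wq full eq_w'.
have neq_x r : w r != 0 -> w r != x.
  by move=> wr; have /andP[/lt_x /=] := mem _ wr; lia.
split=> [r|r r'|r y]; rewrite ?eq_w' ?mem_rcons ?inE.
- by case: (r =P q) => [-> _|_ /mem/andP[-> ->]]; rewrite ?eqxx ?Aq ?orbT.
- case: (r =P q) (r' =P q) => [->|_] [->|_] //.
  + by move=> _ eq_x; have := neq_x r'; rewrite -eq_x eqxx x_n0 => /(_ isT).
  + by move=> wr eq_x; have := neq_x r wr; rewrite eq_x eqxx.
  + exact: inj.
case/predU1P => [-> Ar|ys Ar].
  have [->|neq_r] := eqVneq r q; first by left; rewrite lt0n x_n0 leqnn.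
  have [wr|wr] := eqVneq (w r) 0.
    right; exists q; last by rewrite eq_w' eqxx.
    by rewrite ltn_neqAle neq_r leqNgt; apply/negP => /full/(_ Ar); rewrite wr.
  by left; rewrite lt0n wr; have /andP[/lt_x /ltnW] := mem _ wr.
case: (opt _ _ ys Ar) => [wr|[r' lt_r eq_y]].
  by left; case: (r =P q) wr => [->|//]; rewrite wq.
right; exists r' => //; rewrite eq_w'; case: eqP => // eq_r'.
by move: s0; rewrite -wq -eq_r' eq_y ys.
Qed.

Variant last_iota_spec (N : nat) (P : pred nat) : seq nat -> Prop :=
| LastNone of (forall r, r < N -> ~~ P r) : last_iota_spec N P [::]
| LastSome q0 qs of last q0 qs < N & P (last q0 qs)
    & (forall r, last q0 qs < r < N -> ~~ P r) : last_iota_spec N P (q0 :: qs).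

Lemma last_iotaP N (P : pred nat) : last_iota_spec N P [seq r <- iota 0 N | P r].
Proof.
elim: N => [|N IH]; first exact: LastNone.
rewrite -addn1 iotaD filter_cat add0n /= addn1; case PN: (P N).
  case eq_qs: [seq r <- iota 0 N | P r] => [|q0 qs] /=.
    by apply: (@LastSome _ _ N [::]) => //= r; lia.
  apply: (@LastSome _ _ q0 (qs ++ [:: N])); rewrite last_cat //= => r; lia.
rewrite cats0; case: IH => [none|q0 qs lt_N Pq max_q].
  apply: LastNone => r; rewrite ltnS leq_eqVlt => /predU1P[->|/none//].
  by rewrite PN.
apply: LastSome => //; first by lia.
move=> r /andP[lt_r]; rewrite ltnS leq_eqVlt => /predU1P[->|lt_rN]; first by rewrite PN.
by apply: max_q; rewrite lt_r.
Qed.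

Definition put (A : nat -> nat -> bool) (N : nat) (w : nat -> nat) (x : nat) : nat -> nat :=
  let qs := [seq r <- iota 0 N | (w r == 0) && A r x] in
  if qs is [::] then w else fun r => if r == last 0 qs then x else w r.

Lemma stable_foldl_put (A : nat -> nat -> bool) N s l w : (forall r x, A r x -> r < N) ->
  0 \notin s ++ l -> sorted ltn (s ++ l) -> stable A s w ->
  stable A (s ++ l) (foldl (put A N) w l).
Proof.
move=> A_lt; elim: l s w => [|x l IH] s w; first by rewrite cats0.
rewrite -cat_rcons => sl0 sl_sorted st; apply: IH => //.
have /andP[x_n0 s0] : (x != 0) && (0 \notin s).
  by move: sl0; rewrite mem_cat mem_rcons inE !negb_or eq_sym => /andP[].
have lt_x : all (ltn^~ x) s.
  move: sl_sorted; rewrite (sorted_pairwise ltn_trans) pairwise_cat.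
  by case/and3P => _; rewrite pairwise_rcons => /andP[].
rewrite /put; case: last_iotaP => [none|q0 qs lt_N /andP[/eqP wq Aq] max_q].
  apply: stable_skip => // r Ar; have := none r (A_lt _ _ Ar).
  by rewrite Ar andbT.
apply: (stable_put s0 st lt_x x_n0 Aq wq) => [r lt_r Ar|//].
have /max_q : last q0 qs < r < N by rewrite lt_r (A_lt _ _ Ar).
by rewrite Ar andbT.
Qed.

(** Serves to build the columns for [mid_lt], which need not come from a tableau; those of T and T'
    are read off [phi_inv]. *)
Fixpoint columns_of (R : rel nat) (N : nat) (xs : nat -> seq nat) (v0 : nat -> nat)
    (e : nat) : nat -> nat :=
  if e is e'.+1 then foldl (put (avail R (columns_of R N xs v0 e')) N) (fun=> 0) (xs e)
  else v0.

Lemma columns_of_stable R N xs v0 e :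
  (forall r, v0 r != 0 -> r < N) -> (forall e, sorted ltn (xs e)) ->
  (forall e, 0 \notin xs e) ->
  stable (avail R (columns_of R N xs v0 e)) (xs e.+1) (columns_of R N xs v0 e.+1).
Proof.
move=> v0_lt xs_sorted xs0.
have st e' : (forall r, columns_of R N xs v0 e' r != 0 -> r < N) ->
    stable (avail R (columns_of R N xs v0 e')) (xs e'.+1) (columns_of R N xs v0 e'.+1).
  move=> lt_N; apply: (@stable_foldl_put _ N [::] _ _ _ (xs0 _) (xs_sorted _)) => //.
  by move=> r x /andP[/lt_N].
apply: (st); elim: e => [//|e IH] r; case: (st e IH) => mem _ _ /mem /andP[_].
by case/andP => /IH.
Qed.

(** * The columns of $\varphi^{-1}(T)$ *)

Definition filled (F : filling) (N c : nat) : Prop :=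
  [/\ size F = N, forall r, size (nth [::] F r) <= c &
      forall r e, e < size (nth [::] F r) -> entry F r e != 0].

Lemma entry_default F r e : size (nth [::] F r) <= e -> entry F r e = 0.
Proof. exact: nth_default. Qed.

Lemma filled_entry F N c r e : filled F N c -> (entry F r e != 0) = (e < size (nth [::] F r)).
Proof.
case=> _ _ nz; have [/nz -> //|/entry_default ->] := ltnP e (size (nth [::] F r)).
by [].
Qed.

Lemma place_stable c N F s x (F' := place c.+1 F x)
    (A := avail ltn (entry F ^~ c)) :
  filled F N c.+2 -> 0 \notin s -> x != 0 -> all (ltn^~ x) s ->
  stable A s (entry F ^~ c.+1) ->
  [/\ filled F' N c.+2, (forall r e, e <= c -> entry F' r e = entry F r e) &
      stable A (rcons s x) (entry F' ^~ c.+1)].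
Proof.
move=> fill s0 x_n0 lt_x st; have [szF szr nz] := fill.
(* Entries are nonzero and rows have length at most c + 2, so a row has length c + 1 exactly when
   its cell in column c is filled and its cell in column c + 1 is empty. *)
have cond r : (size (nth [::] F r) == c.+1) && (entry F r c < x) =
              (entry F r c.+1 == 0) && A r x.
  rewrite /A /avail (filled_entry _ _ fill) -[entry F r c.+1 == 0]negbK.
  by rewrite (filled_entry _ _ fill) /=; have := szr r; lia.
rewrite {}/F' /place /= (eq_filter cond) szF.
have A_lt r : A r x -> r < N.
  rewrite /A /avail (filled_entry _ _ fill) -szF => /andP[lt_c _].
  by rewrite ltnNge; apply/negP => ge_r; rewrite nth_default in lt_c.
case: last_iotaP => [none|q0 qs lt_N Pq max_q].
  split=> //; apply: stable_skip => // r Ar.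
  by have := none r (A_lt r Ar); rewrite Ar andbT.
rewrite [last 0 _]/=; set q := last q0 qs in lt_N Pq max_q *.
have szq : size (nth [::] F q) = c.+1 by move: Pq; rewrite -cond => /andP[/eqP].
have eq_nth r : nth [::] (set_nth [::] F q (rcons (nth [::] F q) x)) r =
    if r == q then rcons (nth [::] F q) x else nth [::] F r by rewrite nth_set_nth.
have eq_e r e : entry (set_nth [::] F q (rcons (nth [::] F q) x)) r e =
    if (r == q) && (e == c.+1) then x else entry F r e.
  rewrite /entry eq_nth; case: eqP => [->|//]; rewrite nth_rcons szq /=.
  by case: ltngtP => // lt_e; rewrite ?(ltn_eqF lt_e) // nth_default ?szq // ltnW.
case/andP: Pq => /eqP wq Aq; split.
- split=> [|r|r e].
  + by rewrite size_set_nth szF; apply/maxn_idPr.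
  + by rewrite eq_nth; case: eqP => [_|//]; rewrite size_rcons szq.
  + rewrite eq_e eq_nth; case: (r =P q) => [->|_] /=; last exact: nz.
    rewrite size_rcons szq; case: (e =P c.+1) => [//|ne] lt_e.
    by apply: nz; rewrite szq; lia.
- by move=> r e le_e; rewrite eq_e; case: (e =P c.+1) => [|_]; [lia | rewrite andbF].
apply: (stable_put s0 st lt_x x_n0 Aq wq) => [r lt_r Ar|r].
  have /max_q : q < r < N by rewrite lt_r A_lt.
  by rewrite Ar andbT.
by rewrite eq_e eqxx andbT.
Qed.

Lemma foldl_place_stable c N l F s (F' := foldl (place c.+1) F l)
    (A := avail ltn (entry F ^~ c)) :
  filled F N c.+2 -> 0 \notin s ++ l -> sorted ltn (s ++ l) ->
  stable A s (entry F ^~ c.+1) ->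
  [/\ filled F' N c.+2, (forall r e, e <= c -> entry F' r e = entry F r e) &
      stable A (s ++ l) (entry F' ^~ c.+1)].
Proof.
rewrite {}/F' {}/A; elim: l F s => [|x l IH] F s fill; first by rewrite cats0.
rewrite -cat_rcons => sl0 sl_sorted st.
have /andP[x_n0 s0] : (x != 0) && (0 \notin s).
  by move: sl0; rewrite mem_cat mem_rcons inE !negb_or eq_sym => /andP[].
have lt_x : all (ltn^~ x) s.
  move: sl_sorted; rewrite (sorted_pairwise ltn_trans) pairwise_cat.
  by case/and3P => _; rewrite pairwise_rcons => /andP[].
have [fill' eq_e st'] := place_stable fill s0 x_n0 lt_x st.
have eqA r y : avail ltn (entry F ^~ c) r y = avail ltn (entry (place c.+1 F x) ^~ c) r y.
  by rewrite /avail eq_e.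
have {}st' := stable_ext (fun r y _ => eqA r y) (fun=> erefl) st'.
have [fill'' eq_e' st''] := IH _ _ fill' sl0 sl_sorted st'.
split=> //; first by move=> r e le_e; rewrite /= eq_e' ?eq_e.
by apply: stable_ext st'' => // r y _; rewrite eqA.
Qed.

(** Formulated for any filling with increasing columns of positive letters, so as to cover T'
    together with T. *)
Lemma phi_inv_stable (X : filling) (F := phi_inv X) :
  (forall e, sorted ltn (column X e)) -> (forall e, 0 \notin column X e) ->
  (forall e, size (head [::] X) <= e -> column X e = [::]) ->
  [/\ size F = size (column X 0),
      forall r e, (entry F r e != 0) = (e < size (nth [::] F r)),
      forall r, entry F r 0 = nth 0 (column X 0) r &
      forall e, stable (avail ltn (entry F ^~ e)) (column X e.+1) (entry F ^~ e.+1)].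
Proof.
move=> col_sorted col0 col_nil; rewrite {}/F /phi_inv.
set F0 := [seq [:: x] | x <- column X 0]; set N := size (column X 0).
set Fc := fun c => foldl (fun F c => foldl (place c) F (column X c)) F0 (iota 1 c).
(* After round c the columns 0, ..., c are final; later rounds only append to the right of them. *)
have inv c : [/\ filled (Fc c) N c.+1,
      forall r, entry (Fc c) r 0 = nth 0 (column X 0) r &
      forall e, e < c ->
        stable (avail ltn (entry (Fc c) ^~ e)) (column X e.+1) (entry (Fc c) ^~ e.+1)].
  elim: c => [|c [fill eq0 st]].
    have nthF0 r : r < N -> nth [::] F0 r = [:: nth 0 (column X 0) r].
      by move=> lt_r; rewrite (nth_map 0).
    have nthF0' r : N <= r -> nth [::] F0 r = [::].
      by move=> ge_r; rewrite nth_default // size_map.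
    split=> //.
      split=> [|r|r e]; first by rewrite /Fc /= /F0 size_map.
        by rewrite /Fc /=; have [/nthF0 ->|/nthF0' ->] := ltnP r N.
      rewrite /entry /Fc /=; have [lt_r|/nthF0' ->//] := ltnP r N.
      rewrite nthF0 //; case: e => //= _; apply: contraNneq (col0 0) => e0.
      by rewrite -[X in X \in _]e0 mem_nth.
    move=> r; rewrite /entry /Fc /=; have [/nthF0 -> //|ge_r] := ltnP r N.
    by rewrite nthF0' // (nth_default 0 ge_r).
  have -> : Fc c.+1 = foldl (place c.+1) (Fc c) (column X c.+1).
    have -> : Fc c.+1 = Fc (c + 1) by rewrite addn1.
    by rewrite /Fc iotaD foldl_cat.
  have fill' : filled (Fc c) N c.+2.
    by case: fill => ? szr ?; split=> // r; apply: leqW.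
  have [|fill'' eq_e st'] :=
    @foldl_place_stable c N (column X c.+1) (Fc c) [::] fill' (col0 _) (col_sorted _).
    apply: stable_ext (stable_nil _) => // r; rewrite entry_default //.
    by case: fill.
  split=> // [r|e]; first by rewrite eq_e.
  rewrite ltnS leq_eqVlt => /predU1P[->|lt_e].
    by apply: stable_ext st' => // r y _; rewrite /avail eq_e.
  apply: stable_ext (st _ lt_e) => [r y _|r]; last by rewrite eq_e.
  by rewrite /avail eq_e // ltnW.
have [fill eq0 st] := inv (size (head [::] X)).-1.
split=> //; first by case: fill.
  by move=> r e; rewrite (filled_entry _ _ fill).
move=> e; have [/st//|ge_e] := ltnP e (size (head [::] X)).-1.
(* Past the end of the first row the columns are empty, and the zero column is stable. *)
rewrite col_nil; last by lia.
apply: stable_ext (stable_nil _) => // r; rewrite entry_default //.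
by case: fill => _ szr _; apply: leq_trans (szr r) _.
Qed.

(** * Comparing two sequences of stable columns *)

Definition swap2 (a b x : nat) : nat := if x == a then b else if x == b then a else x.

Lemma swap2l a b : swap2 a b a = b. Proof. by rewrite /swap2 eqxx. Qed.

Lemma swap2r a b : swap2 a b b = a.
Proof. by rewrite /swap2 eqxx; case: eqP => [->|]. Qed.

Lemma swap2_neq a b x : x != a -> x != b -> swap2 a b x = x.
Proof. by rewrite /swap2 => /negbTE -> /negbTE ->. Qed.

Lemma swap2K a b : involutive (swap2 a b).
Proof.
move=> x; have [->|xa] := eqVneq x a; first by rewrite swap2l swap2r.
have [->|xb] := eqVneq x b; first by rewrite swap2r swap2l.
by rewrite !swap2_neq.
Qed.

(* Letters a < b, consecutive in the column, compete for row p: if p takes a in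
   one column and may not take it in the other, then a and b trade places. *)
Lemma stable_swap_letters A A' s w w' a b p :
  stable A s w -> stable A' s w' -> 0 \notin s -> a \in s -> b \in s -> a < b ->
  (forall x, x \in s -> ~~ (a < x < b)) ->
  (forall r x, x \in s -> x != a -> A r x = A' r x) ->
  (forall r, r != p -> A r a -> A' r a) ->
  (forall r, A' r a -> A r b /\ (A r a \/ r < p)) ->
  (forall r, r != p -> A r b -> A' r a /\ (A r a \/ r < p)) ->
  A p a -> A p b -> ~~ A' p a -> (forall x, x \in s -> x < a -> ~~ A p x) ->
  w =1 w' \/
  [/\ w p = a, forall q, w q = b -> q < p & forall r, w' r = swap2 a b (w r)].
Proof.
move=> st st' s0 a_s b_s lt_ab gap eqA A_A' A'_A Ab_A' Apa Apb A'pa Ap_low.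
have [mem inj opt] := st.
have a_n0 : a != 0 by apply: contraNneq s0 => <-.
have b_n0 : b != 0 by apply: contraNneq s0 => <-.
have [wp|wp] := eqVneq (w p) a; last first.
  (* If p does not hold a, then by [Ap_low] the letter a sits above p, so rows below p that newly
     admit a cannot claim it: w is stable for [A'] too. *)
  left; apply: stable_unique s0 _ st'; split=> // [r wr|r x xs].
    have /andP[ws Aw] := mem r wr; rewrite ws /=.
    have [ea|na] := eqVneq (w r) a; last by rewrite -eqA.
    rewrite ea; apply: A_A'; last by rewrite -ea.
    by apply: contraNneq wp => <-; rewrite ea.
  have [->|na] := eqVneq x a; last by rewrite -eqA //; apply: opt.
  case/A'_A => _ [|lt_rp]; first exact: opt.
  case: (opt p a a_s Apa) => [/andP[wp_gt0 le_a]|[r' lt_r eq_a]].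
    have /andP[ws Aw] : (w p \in s) && A p (w p) by apply: mem; rewrite -lt0n.
    by have := Ap_low _ ws; rewrite Aw ltn_neqAle wp le_a => /(_ isT).
  by right; exists r' => //; apply: ltn_trans lt_r.
have uniq_a r : w r = a -> r = p.
  by move=> wr; apply: inj; rewrite wr ?wp.
(* A row above p holding b would admit a and prefer it, while a sits lower, in p; stability excludes
   this. *)
have low_b q : w q = b -> q < p.
  move=> wq; have nqp : q != p by apply/negP => /eqP eq_q; move: wq; rewrite eq_q wp; lia.
  have /andP[_ Aq] : (w q \in s) && A q (w q) by apply: mem; rewrite wq.
  rewrite wq in Aq; case: (Ab_A' q nqp Aq) => _ [Aqa|//].
  case: (opt q a a_s Aqa) => [|[r' lt_r /uniq_a <-//]].
  by rewrite wq; lia.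
right; split=> //.
suff: stable A' s (fun r => swap2 a b (w r)) by move/(stable_unique s0 st').
have below_b r : 0 < w r <= b -> w r != a -> 0 < swap2 a b (w r) <= a.
  move=> /andP[wr_gt0 le_b] na; have [eb|nb] := eqVneq (w r) b.
    by rewrite eb swap2r lt0n a_n0 leqnn.
  have /andP[/gap ws _] : (w r \in s) && A r (w r) by apply: mem; rewrite -lt0n.
  by rewrite swap2_neq //; lia.
split=> [r|r r' wr|r x xs].
- have [ea|na] := eqVneq (w r) a.
    by rewrite ea swap2l b_s (uniq_a r ea) -eqA ?Apb //; lia.
  have [eb|nb] := eqVneq (w r) b.
    rewrite eb swap2r a_s /= => _; have nr : r != p.
      by apply/negP => /eqP er; move: na; rewrite er wp eqxx.
    have /andP[_ Ab] : (w r \in s) && A r (w r) by apply: mem; rewrite eb.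
    by case: (Ab_A' r nr); rewrite -?eb.
  by rewrite swap2_neq // => /mem/andP[ws Aw]; rewrite ws -eqA.
- move/(congr1 (swap2 a b)); rewrite !swap2K; apply: inj.
  by apply: contraNneq wr => ->; rewrite swap2_neq // eq_sym.
have [-> A'r|na] := eqVneq x a.
  have nr : r != p by apply/negP => /eqP er; move: A'pa; rewrite -er A'r.
  have nwa : w r != a by apply/negP => /eqP /uniq_a er; rewrite er eqxx in nr.
  case: (A'_A r A'r) => Arb _; case: (opt r b b_s Arb) => [le_b|[r' lt_r eq_b]].
    by left; apply: below_b.
  by right; exists r' => //; rewrite eq_b swap2r.
rewrite -eqA // => Arx; have [eb|nb] := eqVneq x b.
  rewrite eb in Arx *.
  case: (ltngtP r p) => [lt_r|gt_r|er].
  - by right; exists p => //; rewrite wp swap2l.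
  - left; have nr : r != p by rewrite gtn_eqF.
    have Ara : A r a by case: (Ab_A' r nr Arx) => _ [//|]; lia.
    case: (opt r a a_s Ara) => [/andP[wr_gt0 le_a]|[r' lt_r /uniq_a]]; last by lia.
    have nwa : w r != a by apply/negP => /eqP /uniq_a er; rewrite er eqxx in nr.
    by rewrite swap2_neq //; lia.
  - by left; rewrite er wp swap2l lt0n b_n0 leqnn.
case: (opt r x xs Arx) => [/andP[wr_gt0 le_x]|[r' lt_r eq_x]]; last first.
  by right; exists r' => //; rewrite eq_x swap2_neq.
left; have [ea|nwa] := eqVneq (w r) a.
  by rewrite ea swap2l lt0n b_n0; have := gap x xs; move: le_x na nb; rewrite ea; lia.
have [eb|nwb] := eqVneq (w r) b; last by rewrite swap2_neq // wr_gt0.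
by rewrite eb swap2r lt0n a_n0; move: le_x; rewrite eb; lia.
Qed.

(** Adjacent rows keep their position relative to every third row when they are exchanged. Between
    the two, the upper row ends up with the smaller letter. The extra letter [w q] that row q may
    admit does no harm, since after the exchange it sits just above, in row q + 1. *)
Lemma stable_swap_rows (A A' : nat -> nat -> bool) s w q (tp := swap2 q q.+1) :
  0 \notin s -> stable A s w -> (w q.+1 != 0 -> 0 < w q < w q.+1) ->
  (forall r x, x \in s -> A (tp r) x -> A' r x) ->
  (forall r x, x \in s -> A' r x -> A (tp r) x \/ r = q /\ x = w q) ->
  stable A' s (fun r => w (tp r)).
Proof.
move=> s0 [mem inj opt] lt_w A_A' A'_A; split=> [r|r r' wr eq_w|r x xs A'r].
- by move=> /mem/andP[ws Aw]; rewrite ws A_A'.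
- by rewrite -(swap2K q q.+1 r) -(swap2K q q.+1 r'); congr (swap2 _ _ _); apply: inj wr eq_w.
have x_n0 : x != 0 by apply: contraNneq s0 => <-.
case: (A'_A r x xs A'r) => [Ar|[-> ->]]; last by right; exists q.+1 => //; rewrite /tp swap2r.
case: (opt _ _ xs Ar) => [?|[r' lt_r eq_x]]; first by left.
have [er|nr] := eqVneq r q.+1.
  rewrite er /tp swap2r in Ar lt_r *.
  have [er'|nr'] := eqVneq r' q.+1; first by move: lt_w; rewrite -er' eq_x; left; lia.
  by right; exists r'; rewrite ?swap2_neq //; lia.
right; exists (tp r'); last by rewrite /tp swap2K.
move: lt_r nr; rewrite /tp /swap2.
by case: (r =P q); case: (r =P q.+1); case: (r' =P q); case: (r' =P q.+1) => * //; lia.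
Qed.

(** Here the rows exchange only what they may receive. The larger letter of row q is admissible for
    the old upper row by [A_up], and the letter of row q + 1 for the old lower row by [A_down], so
    the same column remains stable. This is where two exchanged rows become equal again. *)
Lemma stable_merge_rows (A A' : nat -> nat -> bool) s w q :
  0 \notin s -> stable A s w -> w q.+1 != 0 -> (w q != 0 -> w q.+1 < w q) ->
  (forall r x, x \in s -> A' r x = A (swap2 q q.+1 r) x) ->
  (forall x, x \in s -> A q.+1 x -> A q x) ->
  (forall x y, x \in s -> y \in s -> x < y -> A q.+1 x -> A q.+1 y) ->
  stable A' s w.
Proof.
move=> s0 [mem inj opt] w1 lt_w eqA' A_down A_up.
have /andP[w1s A1] := mem _ w1.
split=> // [r wr|r x xs].
  have /andP[ws Aw] := mem r wr; rewrite ws eqA' //=.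
  have [eq0|n0] := eqVneq r q.
    by rewrite eq0 swap2l in ws wr *; apply: A_up A1 => //; apply: lt_w.
  have [eq1|n1] := eqVneq r q.+1; last by rewrite swap2_neq.
  by rewrite eq1 swap2r; apply: A_down.
rewrite eqA' //; have [->|n0] := eqVneq r q.
  by rewrite swap2l => /(A_down _ xs); apply: opt.
have [->|n1] := eqVneq r q.+1; last by rewrite swap2_neq //; apply: opt.
rewrite swap2r => /(opt _ _ xs)[/andP[wq_gt0 le_x]|[r' lt_r eq_x]].
  by left; rewrite lt0n w1; have := lt_w; rewrite -lt0n wq_gt0 => /(_ isT); lia.
have [er'|nr'] := eqVneq r' q.+1; last by right; exists r' => //; lia.
by left; rewrite -er' eq_x leqnn lt0n -eq_x er' w1.
Qed.

Lemma letter_range i m t s z : i + t < z -> z < i + m + s ->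
  (exists2 u, t < u <= m & z = i + u) \/ (exists2 u, 0 < u < s & z = i + m + u).
Proof.
move=> lt_z gt_z; have [le_z|gt_z'] := leqP z (i + m).
  by left; exists (z - i); lia.
by right; exists (z - (i + m)); lia.
Qed.

Section Comparison.

Variables (n N i m K : nat) (col : nat -> nat) (xs : nat -> seq nat).
Hypotheses (mem_xs : forall e x, (x \in xs e) = (0 < x <= n) && (col x == e))
  (xs_sorted : forall e, sorted ltn (xs e)).
Hypotheses (i_gt0 : 0 < i) (le_n : i + 2 * m <= n) (le_Km : K <= m)
  (dyck_col : dyck_columns col i m K).

Let cyc := cycle_fun m (i + K).

(* The comparisons made for T', pulled back to the letters of T. *)
Definition cyc_lt : rel nat := fun y x => cyc y < cyc x.

(* Interpolates between the comparisons of T and of T': the only comparison of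
   T' that matters and is not made this way is that of i + m + K and i + K. *)
Definition mid_lt : rel nat := fun y x =>
  cyc_lt y x && ~~ ((y == i + m + K) && (x == i + K)).

(** The common form of the fillings to compare, [V e r] being the letter in column e and row r:
    [ltn] is for T, [cyc_lt] for T' with its letters pulled back through the cycle, and [mid_lt] for
    the interpolation. *)
Definition chain (R : rel nat) (V : nat -> nat -> nat) : Prop :=
  [/\ forall r, V 0 r != 0 -> V 0 r \in xs 0,
      forall r r', V 0 r != 0 -> V 0 r = V 0 r' -> r = r',
      forall r, V 0 r != 0 -> r < N &
      forall e, stable (avail R (V e)) (xs e.+1) (V e.+1)].

Lemma notin0_xs e : 0 \notin xs e.
Proof. by rewrite mem_xs. Qed.

Lemma chain_mem R V e r : chain R V -> V e r != 0 -> V e r \in xs e.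
Proof.
case=> mem0 _ _ st; case: e => [|e]; first exact: mem0.
by case: (st e) => mem _ _ /mem/andP[].
Qed.

Lemma chain_inj R V e r r' : chain R V -> V e r != 0 -> V e r = V e r' -> r = r'.
Proof.
case=> _ inj0 _ st; case: e => [|e]; first exact: inj0.
by case: (st e) => _ inj _; apply: inj.
Qed.

Lemma chain_pred R V e r : chain R V -> V e.+1 r != 0 -> V e r != 0.
Proof. by case=> _ _ _ st; case: (st e) => mem _ _ /mem/andP[_ /andP[]]. Qed.

Lemma chain_bound R V e r : chain R V -> V e r != 0 -> r < N.
Proof.
move=> ch; elim: e => [|e IH] wr; first by case: ch => _ _ + _; apply.
by apply: IH; apply: chain_pred ch wr.
Qed.

Lemma chain_col R V e r : chain R V -> V e r != 0 -> col (V e r) = e.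
Proof. by move=> ch /(chain_mem ch); rewrite mem_xs => /andP[_ /eqP]. Qed.

Let col_a : forall s t, s < t <= m -> col (i + s) < col (i + t).
Proof. by case: dyck_col. Qed.
Let col_b : forall s t, 0 < s < t -> t <= m -> col (i + m + s) < col (i + m + t).
Proof. by case: dyck_col. Qed.
Let col_low : forall s, 0 < s <= K -> col (i + m + s) <= col (i + s.-1).
Proof. by case: dyck_col. Qed.
Let col_high : forall s, K < s <= m -> col (i + K) < col (i + m + s) <= col (i + s).
Proof. by case: dyck_col. Qed.

Let col_low_lt s : 0 < s <= K -> col (i + m + s) < col (i + K).
Proof.
move=> sK; apply: leq_ltn_trans (col_low sK) _.
by apply: col_a; lia.
Qed.

(** * Comparisons affected by the cycle *)

Lemma cyc_ltE y x : y != i + K -> x != i + K -> (cyc y < cyc x) = (y < x).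
Proof.
move=> ny nx; rewrite /cyc /cycle_fun (negbTE ny) (negbTE nx).
by case: ifP; case: ifP; lia.
Qed.

Lemma cyc_k : cyc (i + K) = i + m + K.
Proof. by rewrite /cyc /cycle_fun eqxx; lia. Qed.

Lemma lt_cyc_k y : y != i + K -> (cyc y < i + m + K) = (y <= i + m + K).
Proof.
move=> nk; rewrite /cyc /cycle_fun (negbTE nk).
by case: ifP; lia.
Qed.

Lemma gt_cyc_k x : x != i + K -> (i + m + K < cyc x) = (i + m + K < x).
Proof.
move=> nk; rewrite /cyc /cycle_fun (negbTE nk).
by case: ifP; lia.
Qed.

(** The cycle reverses only k against the letters of [k + 1, k + m], and none of these shares the
    column of k: a_u with u > K lies to its right, b_u with u <= K to its left. *)
Lemma cyc_mono e x y : x \in xs e -> y \in xs e -> (cyc x < cyc y) = (x < y).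
Proof.
rewrite !mem_xs => /andP[_ /eqP cx] /andP[_ /eqP cy].
have no_between z : col z = col (i + K) -> i + K < z -> i + m + K < z.
  move=> cz lt_z; rewrite ltnNge; apply/negP => le_z.
  have gt_z : z < i + m + K.+1 by lia.
  case: (letter_range lt_z gt_z) => [[u lt_u ez]|[u lt_u ez]].
    by have := col_a lt_u; rewrite -ez cz ltnn.
  by have := @col_low_lt u ltac:(lia); rewrite -ez cz ltnn.
have [ex|nx] := eqVneq x (i + K); have [ey|ny] := eqVneq y (i + K).
- by rewrite ex ey !ltnn.
- have := no_between y; rewrite ex cyc_k gt_cyc_k // cy -cx ex => /(_ erefl).
  by case: (ltnP (i + K) y) => [_ /(_ isT)|]; lia.
- have := no_between x; rewrite ey cyc_k lt_cyc_k // cx -cy ey => /(_ erefl).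
  by case: (ltnP (i + K) x) => [_ /(_ isT)|]; lia.
- exact: cyc_ltE.
Qed.

(** With k on the left, a reversed letter in the next column can only be a_(K+1), as the a_u lie in
    distinct columns and the b_u with u <= K lie left of k. With k on the right, a reversed letter
    in the previous column can only be b_K, which [mid_lt] handles separately. *)
Lemma mid_ltE e y x : y \in xs e -> x \in xs e.+1 ->
  ~~ [&& K < m, y == i + K & x == i + K.+1] -> mid_lt y x = (y < x).
Proof.
rewrite !mem_xs => /andP[_ /eqP cy] /andP[_ /eqP cx] not_ak; rewrite /mid_lt /cyc_lt.
have [ey|ny] := eqVneq y (i + K); have [ex|nx] := eqVneq x (i + K).
- by exfalso; move: cx; rewrite ex -ey cy; lia.
- rewrite ey cyc_k gt_cyc_k // andbF andbT; apply/idP/idP; first by lia.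
  move=> lt_x; rewrite ltnNge; apply/negP => le_x.
  have gt_x : x < i + m + K.+1 by lia.
  case: (letter_range lt_x gt_x) => [[u lt_u eu]|[u lt_u eu]].
    have : u != K.+1 by apply: contraNneq not_ak => eK; rewrite ey eu eK !eqxx; lia.
    move=> nu; have := @col_a K K.+1 ltac:(lia); have := @col_a K.+1 u ltac:(lia).
    by rewrite -eu cx -ey cy; lia.
  by have := @col_low_lt u ltac:(lia); rewrite -eu cx -ey cy; lia.
- rewrite ex cyc_k lt_cyc_k // andbT.
  have -> : (y <= i + m + K) && (y != i + m + K) = (y < i + m + K) by lia.
  apply/idP/idP; last by lia.
  move=> lt_y; rewrite ltnNge; apply/negP => ge_y.
  have gt_y : i + K < y by lia.
  case: (letter_range gt_y lt_y) => [[u lt_u eu]|[u lt_u eu]].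
    by have := col_a lt_u; rewrite -eu -ex cy cx; lia.
  have := @col_b u K ltac:(lia) le_Km; have := @col_low_lt K ltac:(lia).
  by rewrite -eu cy -ex cx; lia.
- by rewrite cyc_ltE // andbF andbT.
Qed.

Lemma mid_cyc_lt e y x : y \in xs e -> x \in xs e.+1 ->
  ~~ [&& 0 < K, y == i + m + K & x == i + K] -> mid_lt y x = cyc_lt y x.
Proof.
move=> ye xe; have [K0|K_gt0] := posnP K; last by rewrite /mid_lt /= => ->; rewrite andbT.
rewrite /mid_lt => _.
(* For K = 0 the letter i + m + K is a_m, which does not lie in the column before that of a_0. *)
have [/andP[/eqP ey /eqP ex]|_] := boolP ((y == _) && _); last by rewrite andbT.
move: ye xe; rewrite ey ex !mem_xs K0 !addn0 => /andP[_ /eqP c1] /andP[_ /eqP c2].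
have [m0|m_gt0] := posnP m; first by move: c1 c2; rewrite m0 addn0; lia.
by have := @col_a 0 m ltac:(lia); rewrite addn0; lia.
Qed.

Lemma mid_chain_ltn W e : chain mid_lt W -> e != col (i + K) ->
  stable (avail ltn (W e)) (xs e.+1) (W e.+1).
Proof.
move=> ch ne; case: (ch) => _ _ _ /(_ e); apply: stable_ext => // r x xe.
rewrite /avail; case: eqP => //= /eqP wr; apply: (mid_ltE (chain_mem ch wr) xe).
by apply: contra ne => /and3P[_ /eqP ek _]; rewrite -ek (chain_col ch wr).
Qed.

(* The columns computed with [mid_lt] agree with those of T, except that a_t and
   b_t may have traded places, a_t being the higher one for T. *)
Definition traded (v w : nat -> nat) (e : nat) : Prop :=
  exists t p, [/\ K < t <= m, col (i + t) = e /\ col (i + m + t) = e, v p = i + t,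
    forall q, v q = i + m + t -> q < p &
    forall r, w r = swap2 (i + t) (i + m + t) (v r)].

Lemma traded_eq0 v w e r : traded v w e -> (w r == 0) = (v r == 0).
Proof. by case=> t [p [_ _ _ _ ->]]; rewrite /swap2; case: ifP; [|case: ifP]; lia. Qed.

(** The affected comparison is a_K against a_(K+1) in the next column. In that case b_(K+1) is
    squeezed into the same column as a_(K+1), no letter of the column lies between them, and
    [stable_swap_letters] applies with p the row of a_K. *)
Lemma mid_traded_start V W e : chain ltn V -> chain mid_lt W -> V e =1 W e ->
  V e.+1 =1 W e.+1 \/ traded (V e.+1) (W e.+1) e.+1.
Proof.
move=> chV chW eqVW; have [_ _ _ /(_ e) stV] := chV; have [_ _ _ /(_ e) stW] := chW.
have eq_avail r x : x \in xs e.+1 -> ~~ [&& K < m, V e r == i + K & x == i + K.+1] ->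
    avail ltn (V e) r x = avail mid_lt (W e) r x.
  move=> xe not_ak; rewrite /avail -eqVW; case: eqP => //= /eqP vr.
  by rewrite (mid_ltE (chain_mem chV vr) xe).
have [/and3P[lt_Km /hasP[p _ /eqP vp] a_mem]|none] := boolP
    [&& K < m, has (fun r => V e r == i + K) (iota 0 N) & i + K.+1 \in xs e.+1]; last first.
  left; apply: stable_unique (notin0_xs _) stV _; apply: stable_ext stW => // r x xe.
  rewrite eq_avail //; apply: contra none => /and3P[-> /eqP vr /eqP <-].
  rewrite xe andbT; apply/hasP; exists r; last exact/eqP.
  by rewrite mem_iota; apply: (chain_bound (e := e) chV); rewrite vr; lia.
have cK1 : col (i + K.+1) = e.+1 by move: a_mem; rewrite mem_xs => /andP[_ /eqP].
have cK : col (i + K) = e by rewrite -vp (chain_col chV) // vp; lia.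
have cb1 : col (i + m + K.+1) = e.+1 by have := @col_high K.+1 ltac:(lia); lia.
have b_mem : i + m + K.+1 \in xs e.+1 by rewrite mem_xs cb1 eqxx andbT; lia.
have xs_gap x : x \in xs e.+1 -> i + K.+1 < x -> x < i + m + K.+1 -> False.
  rewrite mem_xs => /andP[_ /eqP cx] lt_x gt_x.
  case: (letter_range lt_x gt_x) => [[u lt_u eu]|[u lt_u eu]].
    by have := col_a lt_u; rewrite -eu; lia.
  by have := @col_low_lt u ltac:(lia); rewrite -eu; lia.
have v_gap r : V e r != 0 -> V e r < i + m + K.+1 -> V e r < i + K.+1.
  move=> vr gt_v; rewrite ltnNge; apply/negP => le_v; have cv := chain_col chV vr.
  have lt_v : i + K < V e r by lia.
  case: (letter_range lt_v gt_v) => [[u lt_u eu]|[u lt_u eu]].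
    by have := col_a lt_u; rewrite -eu; lia.
  by have := @col_low_lt u ltac:(lia); rewrite -eu; lia.
have neq_p r : r != p -> V e r != 0 -> V e r != i + K.
  by move=> nr vr; apply: contra nr => /eqP er; apply/eqP/(chain_inj chV vr); rewrite vp.
have := stable_swap_letters (p := p) stV stW (notin0_xs _) a_mem b_mem.
case.
- by lia.
- by move=> x xe; apply/negP => /andP[]; apply: xs_gap.
- by move=> r x xe nx; apply: eq_avail => //; rewrite (negbTE nx) !andbF.
- move=> r nr Ar; rewrite -eq_avail //; case/andP: (Ar) => vr _.
  by rewrite (negbTE (neq_p r nr vr)) andbF.
- move=> r; rewrite /avail -eqVW => /andP[vr]; rewrite vr /=.
  have [er|nr] := eqVneq r p; first by rewrite er vp; lia.
  rewrite (mid_ltE (chain_mem chV vr) a_mem); first by lia.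
  by rewrite (negbTE (neq_p r nr vr)) andbF.
- move=> r nr /andP[vr /(v_gap r vr) lt_v]; rewrite /avail -eqVW vr /=.
  rewrite (mid_ltE (chain_mem chV vr) a_mem); first by split=> //; left.
  by rewrite (negbTE (neq_p r nr vr)) andbF.
- by rewrite /avail vp /=; lia.
- by rewrite /avail vp /=; lia.
- rewrite /avail -eqVW vp /mid_lt /cyc_lt cyc_k negb_and; apply/orP; right.
  by rewrite gt_cyc_k; lia.
- by move=> x _ lt_x; rewrite /avail vp /=; lia.
- by left.
by case=> wp low_b eqW; right; exists K.+1, p; split=> //; lia.
Qed.

(** Exchanging a_t and b_t changes admissibility only for letters between them, and in the next
    column only a_(t+1) can be such a letter. If it is there, so is b_(t+1), and the trade
    continues; otherwise the columns agree again. *)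
Lemma mid_traded_next V W e : chain ltn V -> chain mid_lt W -> traded (V e) (W e) e ->
  V e.+1 =1 W e.+1 \/ traded (V e.+1) (W e.+1) e.+1.
Proof.
move=> chV chW [t [p [tK [ca cb] vp low_b eqW]]].
have [_ _ _ /(_ e) stV] := chV.
have stW : stable (avail ltn (W e)) (xs e.+1) (W e.+1).
  by apply: mid_chain_ltn => //; have := @col_a K t ltac:(lia); lia.
have eqW0 r : (W e r == 0) = (V e r == 0).
  by rewrite eqW /swap2; case: ifP; [|case: ifP]; lia.
have eq_avail r x : x \in xs e.+1 -> (t < m -> x != i + t.+1) ->
    avail ltn (V e) r x = avail ltn (W e) r x.
  move=> xe nx; rewrite /avail eqW0; case: eqP => //= _.
  have x_gap : i + t < x -> i + m + t < x.
    move=> lt_x; rewrite ltnNge; apply/negP => le_x.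
    have gt_x : x < i + m + t.+1 by lia.
    move: xe; rewrite mem_xs => /andP[_ /eqP cx].
    case: (letter_range lt_x gt_x) => [[u lt_u eu]|[u lt_u eu]].
      have := nx ltac:(lia); rewrite eu => nu.
      have := @col_a t t.+1 ltac:(lia); have := @col_a t.+1 u ltac:(lia).
      by rewrite -eu; lia.
    have [eut|nut] := eqVneq u t; first by move: cx; rewrite eu eut; lia.
    by have := @col_b u t ltac:(lia) ltac:(lia); rewrite -eu; lia.
  rewrite eqW /swap2; case: eqP => [->|_]; first by apply/idP/idP; lia.
  by case: eqP => [->|//]; apply/idP/idP; lia.
have [/andP[lt_tm a_mem]|none] := boolP ((t < m) && (i + t.+1 \in xs e.+1)); last first.
  left; apply: stable_unique (notin0_xs _) stV _; apply: stable_ext stW => // r x xe.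
  rewrite eq_avail // => lt_tm; apply: contraNneq none => <-.
  by rewrite lt_tm.
have ca1 : col (i + t.+1) = e.+1 by move: a_mem; rewrite mem_xs => /andP[_ /eqP].
have cb1 : col (i + m + t.+1) = e.+1.
  have := @col_high t.+1 ltac:(lia); have := @col_b t t.+1 ltac:(lia) ltac:(lia); lia.
have b_mem : i + m + t.+1 \in xs e.+1 by rewrite mem_xs cb1 eqxx andbT; lia.
have col_b_le u : 0 < u < t.+1 -> col (i + m + u) <= e.
  move=> lt_u; have [-> //|nu] := eqVneq u t; first by rewrite cb.
  by have := @col_b u t ltac:(lia) ltac:(lia); lia.
have xs_gap x : x \in xs e.+1 -> i + t.+1 < x -> x < i + m + t.+1 -> False.
  rewrite mem_xs => /andP[_ /eqP cx] lt_x gt_x.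
  case: (letter_range lt_x gt_x) => [[u lt_u eu]|[u lt_u eu]].
    by have := col_a lt_u; rewrite -eu; lia.
  by have := col_b_le u ltac:(lia); rewrite -eu; lia.
have v_gap r : V e r != 0 -> V e r != i + m + t -> V e r < i + m + t.+1 -> V e r < i + t.+1.
  move=> vr nv gt_v; rewrite ltnNge; apply/negP => le_v; have cv := chain_col chV vr.
  have lt_v : i + t < V e r by lia.
  have gt_v' : V e r < i + m + t by lia.
  case: (letter_range lt_v gt_v') => [[u lt_u eu]|[u lt_u eu]].
    by have := col_a lt_u; rewrite -eu; lia.
  by have := @col_b u t ltac:(lia) ltac:(lia); rewrite -eu; lia.
have neq_p r : r != p -> V e r != 0 -> V e r != i + t.
  by move=> nr vr; apply: contra nr => /eqP er; apply/eqP/(chain_inj chV vr); rewrite vp.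
have := stable_swap_letters (p := p) stV stW (notin0_xs _) a_mem b_mem.
case.
- by lia.
- by move=> x xe; apply/negP => /andP[]; apply: xs_gap.
- by move=> r x xe nx; apply: eq_avail.
- move=> r nr; rewrite /avail eqW0 => /andP[vr lt_v]; rewrite vr /=.
  by rewrite eqW swap2_neq ?neq_p //; lia.
- move=> r; rewrite /avail eqW0 eqW => /andP[vr]; rewrite vr /=.
  have [er|nr] := eqVneq r p; first by rewrite er vp swap2l; lia.
  have [eb|nb] := eqVneq (V e r) (i + m + t); last by rewrite swap2_neq ?neq_p //; lia.
  by move=> _; split; [rewrite eb; lia | right; apply: low_b].
- move=> r nr; rewrite /avail eqW0 => /andP[vr lt_v]; rewrite vr /= eqW.
  have [eb|nb] := eqVneq (V e r) (i + m + t).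
    by rewrite eb swap2r; split; [lia | right; apply: low_b].
  by rewrite swap2_neq ?neq_p //; have := v_gap r vr nb lt_v; split=> //; left.
- by rewrite /avail vp /=; lia.
- by rewrite /avail vp /=; lia.
- by rewrite /avail eqW vp swap2l /=; lia.
- by move=> x _ lt_x; rewrite /avail vp /=; lia.
- by left.
by case=> wp low_b' eqW'; right; exists t.+1, p; split=> //; lia.
Qed.

Lemma mid_occupied V W e r : chain ltn V -> chain mid_lt W -> V 0 =1 W 0 ->
  (W e r == 0) = (V e r == 0).
Proof.
move=> chV chW eq0.
have : V e =1 W e \/ traded (V e) (W e) e.
  elim: e => [|e [eqe|tr]]; first by left.
    exact: mid_traded_start.
  exact: mid_traded_next.
by case=> [->//|/traded_eq0].
Qed.

(** This is condition (I): the columns of a_0, ..., a_K increase strictly, so within the first K + 1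
    columns there is one letter in each. *)
Definition initial_columns : Prop := 0 < K /\ forall t, t <= K -> col (i + t) = t.

(* Where a run of columns shared by a_t and b_(t+1) starts, both letters have the
   same candidate rows, so a_t goes above b_(t+1), and this persists along the
   run; only a run starting in column 0 escapes. *)
Lemma run_above W t e : chain mid_lt W -> t < K ->
  col (i + t) = e -> col (i + m + t.+1) = e ->
  (forall u, u <= t -> col (i + u) = u) \/
  (forall q, W e q = i + m + t.+1 -> exists2 p, q < p & W e p = i + t).
Proof.
move=> ch; elim/ltn_ind: t e => t IH [|e] lt_tK ca cb.
  left=> u le_u; have [ut|nut] := eqVneq u t; last by have := @col_a u t ltac:(lia); lia.
  rewrite ut ca; case: (posnP t) => [->//|t_gt0].
  by have := @col_a 0 t ltac:(lia); lia.
have ltK := @col_a t K ltac:(lia).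
have [mem _ opt] := mid_chain_ltn ch (e := e) ltac:(lia).
have a_mem : i + t \in xs e.+1 by rewrite mem_xs ca eqxx; lia.
have above q : W e.+1 q = i + m + t.+1 -> avail ltn (W e) q (i + t) ->
    exists2 p, q < p & W e.+1 p = i + t.
  by move=> wq /(opt q _ a_mem)[|//] /andP[_]; rewrite wq; lia.
(* The left neighbour of b_(t+1) is smaller than a_t or equal to b_t, because the other letters in
   between lie in other columns. *)
have candidate q : W e.+1 q = i + m + t.+1 ->
    avail ltn (W e) q (i + t) \/ 0 < t /\ W e q = i + m + t.
  move=> wq; have /andP[_ /andP[vq lt_v]] :
      (W e.+1 q \in xs e.+1) && avail ltn (W e) q (W e.+1 q) by apply: mem; rewrite wq; lia.
  rewrite wq /= in lt_v; rewrite /avail vq /=; have cv := chain_col ch vq.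
  have [lt_va|ge_v] := ltnP (W e q) (i + t); [by left | right].
  have [ev|nv] := eqVneq (W e q) (i + t); first by move: cv; rewrite ev ca; lia.
  have gt_v : i + t < W e q by lia.
  case: (letter_range gt_v lt_v) => [[u lt_u eu]|[u lt_u eu]].
    by have := col_a lt_u; rewrite -eu; lia.
  have [ut|nut] := eqVneq u t; first by rewrite eu ut; lia.
  have := @col_b u t ltac:(lia) ltac:(lia); have := @col_low t ltac:(lia).
  by have := @col_a t.-1 t ltac:(lia); rewrite -eu; lia.
have [/and3P[t_gt0 /eqP ca' /eqP cb']|no_run] :=
    boolP [&& 0 < t, col (i + t.-1) == e & col (i + m + t) == e]; last first.
  right=> q wq; case: (candidate q wq) => [/(above q wq)//|[t_gt0 vq]].
  have vq0 : W e q != 0 by rewrite vq; lia.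
  have := chain_col ch vq0; rewrite vq => cb'; move: no_run.
  by have := @col_low t ltac:(lia); have := @col_a t.-1 t ltac:(lia); lia.
case: (IH t.-1 ltac:(lia) e ltac:(lia) ca'); first by rewrite prednK.
  move=> init; left=> u le_u; have [->|nu] := eqVneq u t; last by apply: init; lia.
  by rewrite ca -ca' init; lia.
rewrite prednK // => Z; right=> q wq; case: (candidate q wq) => [/(above q wq)//|[_ vq]].
(* The row p of a_(t-1) is above q and admits a_t, so it holds a_t unless a_t is higher still. *)
have [p lt_p vp] := Z q vq.
have Ap : avail ltn (W e) p (i + t) by rewrite /avail vp /=; lia.
case: (opt p _ a_mem Ap) => [/andP[wp_gt0 le_w]|[r lt_r wr]]; last first.
  by exists r => //; apply: ltn_trans lt_r.
exists p => //; have /andP[_ /andP[_]] :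
    (W e.+1 p \in xs e.+1) && avail ltn (W e) p (W e.+1 p) by apply: mem; rewrite -lt0n.
by rewrite vp /=; lia.
Qed.

(** Only b_K against a_K is judged differently. The row of b_K might claim a_K under [cyc_lt], but
    by [run_above] a higher row holds a_(K-1), and a_K ends up there or higher, so the claim has no
    effect. *)
Lemma mid_cyc_eq W U e : chain mid_lt W -> chain cyc_lt U -> W e =1 U e ->
  ~ initial_columns \/ e.+1 != col (i + K) -> W e.+1 =1 U e.+1.
Proof.
move=> chW chU eqe not_init; have [_ _ _ /(_ e) stW] := chW; have [_ _ _ /(_ e) stU] := chU.
apply: stable_unique (notin0_xs _) _ stU.
have eq_avail r x : x \in xs e.+1 -> ~~ [&& 0 < K, W e r == i + m + K & x == i + K] ->
    avail mid_lt (W e) r x = avail cyc_lt (U e) r x.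
  move=> xe nk; rewrite /avail -eqe; case: eqP => //= /eqP wr.
  exact: mid_cyc_lt (chain_mem chW wr) xe nk.
have [/and3P[K_gt0 /eqP cb /eqP ca]|no_event] := boolP
    [&& 0 < K, col (i + m + K) == e & col (i + K) == e.+1]; last first.
  apply: stable_ext stW => // r x xe; apply: eq_avail => //.
  apply: contra no_event => /and3P[-> /eqP wr /eqP ex] /=; apply/andP; split.
    by apply/eqP; rewrite -wr (chain_col chW) // wr; lia.
  by move: xe; rewrite mem_xs ex => /andP[].
case: not_init => [not_init|]; last by rewrite ca eqxx.
have ca' : col (i + K.-1) = e.
  by have := @col_low K ltac:(lia); have := @col_a K.-1 K ltac:(lia); lia.
case: (@run_above W K.-1 e chW ltac:(lia) ca'); first by rewrite prednK.
  move=> init; case: not_init; split=> // t le_t.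
  have [->|nt] := eqVneq t K; last by apply: init; lia.
  by rewrite ca -ca' init; lia.
rewrite prednK // => Z; have [mem inj opt] := stW.
split=> // [r wr|r x xe].
  have /andP[ws Aw] := mem r wr; rewrite ws /= -eq_avail //.
  apply/negP => /and3P[_ /eqP vr /eqP ex]; move: Aw.
  by rewrite /avail vr ex /mid_lt !eqxx !andbF.
have [/andP[/eqP vr /eqP ex]|nk] := boolP ((W e r == i + m + K) && (x == i + K)); last first.
  by rewrite -eq_avail //; [apply: opt | apply: contra nk => /and3P[_ -> ->]].
move=> _; have [p lt_p vp] := Z r vr.
have Ap : avail mid_lt (W e) p x.
  have vp0 : W e p != 0 by rewrite vp; lia.
  rewrite /avail vp0 (mid_ltE (chain_mem chW vp0) xe) ?vp ?ex; lia.
case: (opt p x xe Ap) => [/andP[wp_gt0 le_w]|[r' lt_r wr']]; last first.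
  by right; exists r' => //; apply: ltn_trans lt_r.
right; exists p => //; have [mem' _ _] := mid_chain_ltn chW (e := e) ltac:(lia).
have /andP[_ /andP[_]] : (W e.+1 p \in xs e.+1) && avail ltn (W e) p (W e.+1 p).
  by apply: mem'; rewrite -lt0n.
by rewrite vp ex /=; lia.
Qed.

Lemma mid_cyc_eq_noninitial W U e : chain mid_lt W -> chain cyc_lt U -> W 0 =1 U 0 ->
  ~ initial_columns -> W e =1 U e.
Proof.
move=> chW chU eq0 not_init; elim: e => [//|e IH].
by apply: mid_cyc_eq => //; left.
Qed.

(** * Initial columns: exchanging the ends of rows q and q + 1 *)

Section Initial.

Variables (W U : nat -> nat -> nat) (q : nat).
Hypotheses (init : initial_columns) (chW : chain mid_lt W) (chU : chain cyc_lt U)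
  (eq0 : W 0 =1 U 0) (Wq : W 0 q = i) (Wq1 : W 0 q.+1 = i + m + 1)
  (W_above : forall r, q.+1 < r -> W 0 r != 0 -> i + 2 * m < W 0 r).

Let K_gt0 : 0 < K. Proof. by case: init. Qed.
Let col_init t : t <= K -> col (i + t) = t. Proof. by case: init => _; apply. Qed.
Let tp := swap2 q q.+1.

(** Rows above q + 1 contain only letters beyond i + 2m and never compete. The letters a_(t+1) and
    b_(t+2) lie in the next column, the latter squeezed between b_(t+1) and a_(t+1); each directly
    follows its left neighbour in value, so the row has no smaller choice. *)
Lemma initial_rows t : t <= K ->
  [/\ W t q = i + t, t < K -> W t q.+1 = i + m + t.+1 &
      forall r, q.+1 < r -> W t r != 0 -> i + 2 * m < W t r].
Proof.
elim: t => [_|t IH lt_tK]; first by rewrite addn0.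
have [vq /(_ lt_tK) vq1 v_above] := IH (ltnW lt_tK).
have ct := col_init (ltnW lt_tK); have cK := col_init (leqnn K).
have [mem _ opt] := mid_chain_ltn chW (e := t) ltac:(lia).
have {}mem r : W t.+1 r != 0 -> W t r < W t.+1 r /\ W t r != 0.
  by move=> /mem/andP[_ /andP[]].
have memE x : 0 < x <= n -> col x = t.+1 -> x \in xs t.+1.
  by move=> x_mem cx; rewrite mem_xs x_mem cx eqxx.
split=> [||r lt_r wr]; last first.
- by have [lt_v /(v_above r lt_r)] := mem r wr; lia.
- move=> lt_tK1; have cb : col (i + m + t.+2) = t.+1.
    have := @col_low t.+2 ltac:(lia); rewrite /= (col_init lt_tK) => le_b.
    have vq1_n0 : W t q.+1 != 0 by rewrite vq1; lia.
    have := chain_col chW vq1_n0; rewrite vq1 => cb.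
    by have := @col_b t.+1 t.+2 ltac:(lia) ltac:(lia); lia.
  have Aq1 : avail ltn (W t) q.+1 (i + m + t.+2) by rewrite /avail vq1 /=; lia.
  case: (opt _ _ (memE (i + m + t.+2) ltac:(lia) cb) Aq1) => [/andP[wr_gt0 le_w]|[r lt_r wr]].
    by have [] := mem q.+1 ltac:(lia); rewrite vq1; lia.
  by have [lt_v vr] := mem r ltac:(lia); have := v_above r lt_r vr; lia.
have Aq : avail ltn (W t) q (i + t.+1) by rewrite /avail vq /=; lia.
case: (opt _ _ (memE (i + t.+1) ltac:(lia) (col_init lt_tK)) Aq)
  => [/andP[wr_gt0 le_w]|[r lt_r wr]].
  by have [] := mem q ltac:(lia); rewrite vq; lia.
have [lt_v vr] := mem r ltac:(lia).
have [er|nr] := eqVneq r q.+1; first by move: lt_v; rewrite wr er vq1; lia.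
by have := v_above r ltac:(lia) vr; lia.
Qed.

Lemma initial_eq e : e < K -> W e =1 U e.
Proof.
elim: e => [//|e IH] lt_e; apply: mid_cyc_eq => //; first by apply: IH; lia.
by right; rewrite (col_init (leqnn K)); lia.
Qed.

Definition swapped e : Prop :=
  (forall r, U e r = W e (tp r)) /\ (W e q.+1 != 0 -> 0 < W e q < W e q.+1).

(** In column K - 1 the two rows hold a_(K-1) and b_K, and a_K is the only letter of column K
    between these. So the rows admit the same letters except a_K, which [mid_lt] denies to the row
    of b_K and [cyc_lt] grants; this is the exception allowed in [stable_swap_rows]. *)
Lemma initial_swapped : swapped K.
Proof.
have cK := col_init (leqnn K).
have [wq _ _] := initial_rows (leqnn K).
have [vq /(_ ltac:(lia)) vq1 v_above] := initial_rows (leq_pred K).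
rewrite prednK // in vq1.
have [_ _ _ /(_ K.-1) stW] := chW; have [_ _ _ /(_ K.-1) stU] := chU.
rewrite prednK // in stW stU.
have eqv := initial_eq (e := K.-1) ltac:(lia).
have below_K r x : x \in xs K -> W K.-1 r != 0 -> W K.-1 r != i + m + K \/ x != i + K ->
    mid_lt (W K.-1 r) x = (W K.-1 r < x) /\ cyc_lt (W K.-1 r) x = (W K.-1 r < x).
  move=> xe vr nbk; have ve := chain_mem chW vr.
  have xe' : x \in xs K.-1.+1 by rewrite prednK.
  have mE : mid_lt (W K.-1 r) x = (W K.-1 r < x).
    apply: mid_ltE ve xe' _; apply/negP => /and3P[_ /eqP vk _].
    by have := chain_col chW vr; rewrite vk cK; lia.
  split=> //; rewrite -mE (mid_cyc_lt ve xe') //.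
  by case: nbk => /negbTE ->; rewrite ?andbF.
have x_gap x : x \in xs K -> x != i + K -> (i + m + K < x) = (i + K.-1 < x).
  rewrite mem_xs => /andP[_ /eqP cx] nx; apply/idP/idP; first by lia.
  move=> lt_x; rewrite ltnNge; apply/negP => le_x.
  have gt_x : x < i + m + K.+1 by lia.
  case: (letter_range lt_x gt_x) => [[u lt_u eu]|[u lt_u eu]].
    by have := @col_a K u ltac:(lia); rewrite -eu; lia.
  by have := @col_low_lt u ltac:(lia); rewrite -eu; lia.
have v1_n0 : W K.-1 q.+1 != 0 by rewrite vq1; lia.
have v_n0 : W K.-1 q != 0 by rewrite vq; lia.
have neq1 r : r != q.+1 -> W K.-1 r != 0 -> W K.-1 r != i + m + K.
  by move=> nr vr; apply: contra nr => /eqP er; apply/eqP/(chain_inj chW vr); rewrite vq1.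
have bK_k : mid_lt (i + m + K) (i + K) = false by rewrite /mid_lt !eqxx andbF.
have bK_k' : cyc_lt (i + m + K) (i + K) by rewrite /cyc_lt cyc_k lt_cyc_k; lia.
have lt_w : W K q.+1 != 0 -> 0 < W K q < W K q.+1.
  case: stW => mem _ _ /mem/andP[ws /andP[_]]; rewrite vq1 wq.
  have [ek|nk] := eqVneq (W K q.+1) (i + K); first by rewrite ek bK_k.
  by have [] := below_K q.+1 _ ws v1_n0 (or_intror nk); rewrite vq1; lia.
have v_q1 x : x \in xs K -> mid_lt (i + m + K) x -> i + K.-1 < x.
  move=> xe; have [->|nx] := eqVneq x (i + K); first by rewrite bK_k.
  by have [+ _] := below_K q.+1 x xe v1_n0 (or_intror nx); rewrite vq1 x_gap // => ->.
split=> //; suff st : stable (avail cyc_lt (U K.-1)) (xs K) (fun r => W K (tp r)).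
  by move=> r; rewrite (stable_unique (notin0_xs _) stU st).
have cE r x : x \in xs K -> r != q.+1 -> W K.-1 r != 0 ->
    mid_lt (W K.-1 r) x = (W K.-1 r < x) /\ cyc_lt (W K.-1 r) x = (W K.-1 r < x).
  by move=> xe nr vr; apply: below_K => //; left; apply: neq1.
have cE1 x : x \in xs K -> x != i + K ->
    mid_lt (i + m + K) x = (i + K.-1 < x) /\ cyc_lt (i + m + K) x = (i + K.-1 < x).
  move=> xe nx; have := below_K q.+1 x xe v1_n0 (or_intror nx).
  by rewrite vq1 x_gap.
have cE0 x : x \in xs K -> mid_lt (i + K.-1) x = (i + K.-1 < x) /\
    cyc_lt (i + K.-1) x = (i + K.-1 < x).
  by move=> xe; have := cE q x xe ltac:(lia) v_n0; rewrite vq.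
apply: stable_swap_rows (notin0_xs _) stW lt_w _ _ => r x xe; rewrite /avail -eqv -/tp.
- have [->|n0] := eqVneq r q.
    rewrite /tp swap2l vq vq1 => /andP[_ /(v_q1 x xe)].
    by have [_ ->] := cE0 x xe; lia.
  have [->|n1] := eqVneq r q.+1.
    rewrite /tp swap2r vq vq1 => /andP[_]; have [-> _] := cE0 x xe => lt_x.
    have [->|nx] := eqVneq x (i + K); first by rewrite bK_k'; lia.
    by have [_ ->] := cE1 x xe nx; lia.
  rewrite /tp swap2_neq // => /andP[vr]; rewrite vr /=.
  by have [-> ->] := cE r x xe n1 vr.
- have [->|n0] := eqVneq r q.
    rewrite /tp swap2l vq vq1 => /andP[_]; have [_ ->] := cE0 x xe => lt_x.
    have [->|nx] := eqVneq x (i + K); first by right.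
    by left; have [-> _] := cE1 x xe nx; lia.
  have [->|n1] := eqVneq r q.+1.
    rewrite /tp swap2r vq vq1 => /andP[_]; have [-> _] := cE0 x xe => lt_x.
    left; have [->|nx] := eqVneq x (i + K); first by lia.
    by move: lt_x; have [_ ->] := cE1 x xe nx; lia.
  rewrite /tp swap2_neq // => /andP[vr]; rewrite vr /=.
  by have [-> ->] := cE r x xe n1 vr; left.
Qed.

Definition merged e : Prop :=
  [/\ W e =1 U e, W e q != 0 -> 0 < W e q.+1 < W e q &
      forall e' r, e' <= e ->
        (W e' r == 0) = (U e' r == 0) /\ (W e' q != 0 -> W e' q.+1 != 0)].

Let avail_W e r x : K <= e -> x \in xs e.+1 ->
  avail mid_lt (W e) r x = avail cyc_lt (W e) r x.
Proof.
move=> le_e xe; rewrite /avail; case: eqP => //= /eqP ur.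
rewrite (mid_cyc_lt (chain_mem chW ur) xe) //; apply/negP => /and3P[_ _ /eqP ex].
by move: xe; rewrite mem_xs ex (col_init (leqnn K)) => /andP[_ /eqP]; lia.
Qed.

(** Its smaller left neighbour entitles row q + 1 to whatever row q receives; being the higher row,
    it obtains something smaller. *)
Lemma merged_next e : K <= e -> merged e -> merged e.+1.
Proof.
move=> le_e [eqe lt_w hist].
have [_ _ _ /(_ e) stW] := chW; have [_ _ _ /(_ e) stU] := chU.
have eqe1 : W e.+1 =1 U e.+1.
  apply: stable_unique (notin0_xs _) stW _; apply: stable_ext stU => // r x xe.
  by rewrite avail_W // /avail eqe.
have lt_w1 : W e.+1 q != 0 -> 0 < W e.+1 q.+1 < W e.+1 q.
  case: (stW) => mem inj opt wq; have /andP[ws Aw] := mem q wq.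
  rewrite avail_W // in Aw; have /andP[vq lt_v] := Aw.
  have /andP[vq1_gt0 lt_v1] := lt_w vq.
  have vq1 : W e q.+1 != 0 by rewrite -lt0n.
  have A1 : avail mid_lt (W e) q.+1 (W e.+1 q).
    rewrite avail_W // /avail vq1 /=; apply: ltn_trans lt_v.
    by rewrite (cyc_mono (chain_mem chW vq1) (chain_mem chW vq)).
  case: (opt _ _ ws A1) => [/andP[-> ]|[r lt_r wr]]; last first.
    by have := inj q r wq (esym wr); lia.
  rewrite leq_eqVlt => /predU1P[ew|//].
  by have := inj q q.+1 wq (esym ew); lia.
split=> // e' r; rewrite leq_eqVlt => /predU1P[->|]; last exact: hist.
by split; [rewrite eqe1 | move=> /lt_w1; lia].
Qed.

(** If in W row q + 1 is empty or holds the larger of two letters, the exchange persists by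
    [stable_swap_rows]. Otherwise [stable_merge_rows] makes the columns equal. *)
Lemma swapped_next e : K <= e -> (forall e', K <= e' <= e -> swapped e') ->
  swapped e.+1 \/ merged e.+1.
Proof.
move=> le_e hist; have [eqU lt_w] := hist e ltac:(lia).
have [_ _ _ /(_ e) stW] := chW; have [_ _ _ /(_ e) stU] := chU.
have availE r x : x \in xs e.+1 -> avail cyc_lt (U e) r x = avail mid_lt (W e) (tp r) x.
  by move=> xe; rewrite avail_W // /avail eqU.
have [w1|w1] := eqVneq (W e.+1 q.+1) 0.
  left; split; last by rewrite w1.
  suff st : stable (avail cyc_lt (U e)) (xs e.+1) (fun r => W e.+1 (tp r)).
    by move=> r; rewrite (stable_unique (notin0_xs _) stU st).
  apply: stable_swap_rows (notin0_xs _) stW _ _ _; first by rewrite w1.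
    by move=> r x xe; rewrite availE.
  by move=> r x xe; rewrite availE //; left.
have [lt_q|ge_q] := boolP (0 < W e.+1 q < W e.+1 q.+1).
  left; split=> //.
  suff st : stable (avail cyc_lt (U e)) (xs e.+1) (fun r => W e.+1 (tp r)).
    by move=> r; rewrite (stable_unique (notin0_xs _) stU st).
  apply: stable_swap_rows (notin0_xs _) stW _ _ _ => //.
    by move=> r x xe; rewrite availE.
  by move=> r x xe; rewrite availE //; left.
right.
have gt_q : W e.+1 q != 0 -> W e.+1 q.+1 < W e.+1 q.
  case: (stW) => _ inj _ wq; have ne : W e.+1 q != W e.+1 q.+1.
    by apply/negP => /eqP /(inj q _ wq); lia.
  by lia.
have eqe1 : W e.+1 =1 U e.+1.
  apply: stable_unique (notin0_xs _) _ stU.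
  apply: stable_merge_rows (notin0_xs _) stW w1 gt_q availE _ _.
    move=> x xe; rewrite !avail_W // => /andP[vq1 lt_x].
    have /andP[vq_gt0 lt_v] := lt_w vq1.
    have vq : W e q != 0 by rewrite -lt0n.
    rewrite /avail vq /=; apply: ltn_trans lt_x.
    by rewrite (cyc_mono (chain_mem chW vq) (chain_mem chW vq1)).
  move=> x y xe ye lt_xy; rewrite !avail_W // => /andP[vq1 lt_x].
  by rewrite /avail vq1 /=; apply: ltn_trans lt_x _; rewrite (cyc_mono xe ye).
(* Row q + 1 reaches column e + 1, so it is occupied in all earlier columns, and while swapped so is
   row q; exchanging two occupied cells leaves occupancy unchanged. *)
have occ e' : e' <= e.+1 -> W e' q.+1 != 0.
  move=> le_e'; rewrite -(subKn le_e'); elim: (e.+1 - e') => [|d IH]; first by rewrite subn0.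
  have [le_d|gt_d] := leqP d.+1 e.+1; last first.
    by rewrite (_ : e.+1 - d.+1 = e.+1 - d) //; lia.
  by apply: chain_pred chW _; rewrite subnSK.
split=> // [wq|e' r le_e'].
  by rewrite lt0n w1 gt_q.
split; last by move=> _; apply: occ.
have [lt_K|ge_K] := ltnP e' K; first by rewrite initial_eq.
move: le_e'; rewrite leq_eqVlt => /predU1P[->|lt_e']; first by rewrite eqe1.
have [eqU' lt_w'] := hist e' ltac:(lia).
have w1' := occ e' ltac:(lia); have w0' := lt_w' w1'.
rewrite eqU'; have [->|n0] := eqVneq r q; first by rewrite /tp swap2l; lia.
have [->|n1] := eqVneq r q.+1; first by rewrite /tp swap2r; lia.
by rewrite /tp swap2_neq.
Qed.

Lemma swapped_or_merged e : K <= e ->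
  (forall e', K <= e' <= e -> swapped e') \/ merged e.
Proof.
move=> /subnKC <-; elim: (e - K) => [|d IH].
  left=> e' Ke; have -> : e' = K by lia.
  exact: initial_swapped.
rewrite addnS; case: IH => [sw|mg]; last by right; apply: merged_next; rewrite ?leq_addr.
case: (swapped_next (leq_addr d K) sw) => [sw1|]; [left=> e' Ke | by right].
have [->//|ne] := eqVneq e' (K + d).+1.
by apply: sw; lia.
Qed.

(** While swapped, row q is occupied wherever row q + 1 is, so a discrepancy means that q is
    occupied and q + 1 is not. Before column K and once merged, the columns coincide. *)
Lemma initial_occupied :
  (exists e r, (W e r == 0) != (U e r == 0)) <-> (exists e, W e q != 0 /\ W e q.+1 = 0).
Proof.
split=> [[e [r]]|[e [wq wq1]]].
  have [lt_K|ge_K] := ltnP e K; first by rewrite initial_eq // eqxx.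
  case: (swapped_or_merged ge_K) => [/(_ e ltac:(lia))[eqU lt_w]|[eqe _ _]]; last first.
    by rewrite eqe eqxx.
  rewrite eqU; have [->|n0] := eqVneq r q.
    by rewrite /tp swap2l => ne; exists e; split; have := lt_w; lia.
  have [->|n1] := eqVneq r q.+1.
    by rewrite /tp swap2r => ne; exists e; split; have := lt_w; lia.
  by rewrite /tp swap2_neq // eqxx.
have [lt_K|ge_K] := ltnP e K.
  by have [_ /(_ lt_K) vq1 _] := initial_rows (ltnW lt_K); move: wq1; rewrite vq1; lia.
exists e, q; case: (swapped_or_merged ge_K)
  => [/(_ e ltac:(lia))[eqU lt_w]|[_ _ /(_ e q (leqnn e))[_ /(_ wq)]]].
  by rewrite eqU /tp swap2l wq1 (negbTE wq).
by rewrite wq1.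
Qed.

End Initial.

Lemma occupied_noninitial V U e r : chain ltn V -> chain cyc_lt U -> V 0 =1 U 0 ->
  ~ initial_columns -> (V e r == 0) = (U e r == 0).
Proof.
move=> chV chU eq0 not_init; have [mem0 inj0 lt0 _] := chV.
have chW : chain mid_lt (columns_of mid_lt N xs (V 0)).
  by split=> // e'; apply: columns_of_stable lt0 xs_sorted notin0_xs.
rewrite -(mid_occupied e r chV chW) //.
by rewrite (mid_cyc_eq_noninitial e chW chU).
Qed.

Lemma occupied_initial V U q : chain ltn V -> chain cyc_lt U -> V 0 =1 U 0 ->
  initial_columns -> V 0 q = i -> V 0 q.+1 = i + m + 1 ->
  (forall r, q.+1 < r -> V 0 r != 0 -> i + 2 * m < V 0 r) ->
  (exists e r, (V e r == 0) != (U e r == 0)) <-> (exists e, V e q != 0 /\ V e q.+1 = 0).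
Proof.
move=> chV chU eq0 init Vq Vq1 V_above; have [mem0 inj0 lt0 _] := chV.
have chW : chain mid_lt (columns_of mid_lt N xs (V 0)).
  by split=> // e'; apply: columns_of_stable lt0 xs_sorted notin0_xs.
set W := columns_of _ _ _ _ in chW.
have occ e r : (W e r == 0) = (V e r == 0) by apply: mid_occupied.
have H := initial_occupied init chW chU eq0 Vq Vq1 V_above.
split=> [[e [r ne]]|[e [vq vq1]]].
  have [|e' [wq /eqP wq1]] := proj1 H; first by exists e, r; rewrite occ.
  by exists e'; split; [rewrite -occ | apply/eqP; rewrite -occ].
have [|e' [r ne]] := proj2 H.
  by exists e; split; [rewrite occ | apply/eqP; rewrite occ vq1].
by exists e', r; rewrite -occ.
Qed.

End Comparison.

(** * Relabelling by the cycle *)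

(** Rewrites the columns of T' over the letters of T, so that both chains use the same letters in
    each column. *)
Lemma stable_pullback (f g : nat -> nat) v s w : cancel f g -> cancel g f -> f 0 = 0 ->
  {in s &, {mono f : x y / x < y}} ->
  stable (avail ltn v) [seq f x | x <- s] w ->
  stable (avail (fun y x => f y < f x) (fun r => g (v r))) s (fun r => g (w r)).
Proof.
move=> fK gK f0 f_mono [mem inj opt].
have g_eq0 y : (g y == 0) = (y == 0) by rewrite -{1}(fK 0) f0 (can_eq gK).
have mem_g r : w r != 0 -> g (w r) \in s.
  by move=> /mem/andP[/mapP[x xs ->] _]; rewrite fK.
split=> [r|r r'|r x xs]; rewrite /avail ?g_eq0 ?gK.
- by move=> wr; rewrite mem_g //=; have /andP[_] := mem r wr.
- by move=> wr /(can_inj gK); apply: inj.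
move=> Ar; case: (opt r (f x) (map_f f xs) Ar) => [/andP[wr_gt0 le_w]|[r' lt_r wr']].
  have wr : w r != 0 by rewrite -lt0n.
  by left; rewrite lt0n g_eq0 wr leqNgt -f_mono ?mem_g // gK -leqNgt.
by right; exists r'; rewrite // wr' fK.
Qed.

Definition cycle_inv (m k y : nat) : nat :=
  if y == k + m then k else if k <= y < k + m then y.+1 else y.

Lemma cycle_funK m k : cancel (cycle_fun m k) (cycle_inv m k).
Proof.
move=> x; rewrite /cycle_fun; case: (x =P k) => [->|nx]; first by rewrite /cycle_inv eqxx.
by have [x_btw|x_btw] := boolP (k < x <= k + m); rewrite /cycle_inv; do 2?case: ifP; lia.
Qed.

Lemma cycle_invK m k : cancel (cycle_inv m k) (cycle_fun m k).
Proof.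
move=> y; rewrite /cycle_inv; case: (y =P k + m) => [->|ny]; first by rewrite /cycle_fun eqxx.
by have [y_btw|y_btw] := boolP (k <= y < k + m); rewrite /cycle_fun; do 2?case: ifP; lia.
Qed.

Lemma column_act f T e : column (act f T) e = [seq f x | x <- column T e].
Proof.
rewrite /column /act filter_map -!map_comp.
have -> : [seq s <- T | preim (map f) (fun s => e < size s) s] = [seq s <- T | e < size s].
  by apply: eq_filter => s /=; rewrite size_map.
apply/eq_in_map => s; rewrite mem_filter => /andP[lt_e _] /=.
by rewrite (nth_map 0).
Qed.

Lemma chain_phi_inv n la T (V := fun e r => entry (phi_inv T) r e) :
  is_partition la n -> is_SYT la T ->
  [/\ chain (size (column T 0)) (column T) ltn V,
      forall r, V 0 r = entry T r 0, size (shape (phi_inv T)) = size (column T 0) &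
      forall e r, (V e r == 0) = (nth 0 (shape (phi_inv T)) r <= e)].
Proof.
move=> la_part T_syt.
have [sizeF occ eq0 st] := phi_inv_stable (sorted_SYT_column la_part T_syt)
  (fun e => negbT (mem_SYT_column la_part T_syt e 0)) (SYT_column_nil la_part T_syt).
split; last first.
- by move=> e r; rewrite nth_shape leqNgt -occ negbK.
- by rewrite size_map.
- by move=> r; rewrite /V eq0 (nth_SYT_column0 la_part T_syt).
have lt_N r : V 0 r != 0 -> r < size (column T 0).
  by rewrite /V eq0; apply: contraR; rewrite -leqNgt => ge_r; rewrite nth_default.
split=> // r; first by move=> /lt_N lt_r; rewrite /V eq0 mem_nth.
move=> r' Vr Vrr'; have Vr' : V 0 r' != 0 by rewrite -Vrr'.
apply/eqP; rewrite -(nth_uniq 0 (lt_N r Vr) (lt_N r' Vr')) -?eq0; first exact/eqP.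
exact: sorted_uniq ltn_trans ltnn _ (sorted_SYT_column la_part T_syt 0).
Qed.

Lemma chain_phi_inv_act n la T i m K (F' := phi_inv (act (cycle_fun m (i + K)) T))
    (U := fun e r => cycle_inv m (i + K) (entry F' r e)) :
  is_partition la n -> is_SYT la T -> 0 < i -> i + 2 * m <= n -> K <= m ->
  dyck_columns (col_of T) i m K ->
  [/\ chain (size (column T 0)) (column T) (cyc_lt i m K) U,
      forall r, U 0 r = entry T r 0, size (shape F') = size (column T 0) &
      forall e r, (U e r == 0) = (nth 0 (shape F') r <= e)].
Proof.
move=> la_part T_syt i_gt0 le_n le_K dyck_col; set f := cycle_fun m (i + K).
have mem_xs := mem_SYT_column la_part T_syt.
have f_mono e : {in column T e &, {mono f : x y / x < y}}.
  move=> x y xe ye; exact: (cyc_mono mem_xs i_gt0 le_n le_K dyck_col xe ye).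
(* The cycle fixes 0 because i + K > 0, so 0 still marks the empty cells. *)
have f0 : f 0 = 0 by rewrite /f /cycle_fun; do 2?case: ifP; lia.
have g0 : cycle_inv m (i + K) 0 = 0 by rewrite -[X in cycle_inv _ _ X]f0 cycle_funK.
have f_sorted e : sorted ltn (column (act f T) e).
  rewrite column_act;
  apply: (homo_sorted_in (P := mem (column T e))) (sorted_SYT_column la_part T_syt e).
    by move=> x y xe ye lt_xy; rewrite /= (f_mono e).
  exact/allP.
have f_pos e : 0 \notin column (act f T) e.
  rewrite column_act; apply/mapP => -[x xe /(congr1 (cycle_inv m (i + K)))].
  by rewrite cycle_funK g0 => x0; move: xe; rewrite -x0 mem_xs.
have f_nil e : size (head [::] (act f T)) <= e -> column (act f T) e = [::].
  rewrite column_act; have -> : size (head [::] (act f T)) = size (head [::] T).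
    by case: (T) => //= s ?; rewrite size_map.
  by move=> /(SYT_column_nil la_part T_syt) ->.
have [sizeF occ eq0 st] := phi_inv_stable f_sorted f_pos f_nil.
have U0 r : U 0 r = entry T r 0.
  rewrite /U /F' eq0 column_act -(nth_SYT_column0 la_part T_syt).
  have [lt_r|ge_r] := ltnP r (size (column T 0)); first by rewrite (nth_map 0) // cycle_funK.
  by rewrite (nth_default 0 ge_r) nth_default // size_map.
split=> //; last first.
- move=> e r; rewrite nth_shape leqNgt -occ negbK -[X in _ == X]g0.
  exact: can_eq (cycle_invK _ _) _ _.
- by rewrite size_map sizeF column_act size_map.
have [[mem0 inj0 lt0 _] V0 _ _] := chain_phi_inv la_part T_syt.
have U0V r : U 0 r = entry (phi_inv T) r 0 by rewrite U0 V0.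
split=> [r|r r'|r|e]; rewrite ?U0V; [exact: mem0 | exact: inj0 | exact: lt0 |].
apply: (stable_pullback (f := f)) => //.
- exact: cycle_funK.
- exact: cycle_invK.
by have := st e; rewrite column_act.
Qed.

(** * Condition (I) and the comparison of shapes *)

Lemma col_spread col i m K s t : dyck_columns col i m K -> s <= t -> t <= m ->
  col (i + s) + (t - s) <= col (i + t).
Proof.
case=> col_a _ _ _ le_st.
have spread d : s + d <= m -> col (i + s) + d <= col (i + (s + d)).
  elim: d => [|d IH] le_m; first by rewrite !addn0.
  by have := IH ltac:(lia); have := col_a (s + d) (s + d.+1) ltac:(lia); lia.
by have := spread (t - s); rewrite subnKC.
Qed.

(** Strict increase leaves a_t no column but t once a_K is in column K. *)
Lemma initial_columnsP col i m K : dyck_columns col i m K -> K <= m ->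
  reflect (initial_columns i K col) ((0 < K) && (col (i + K) == K)).
Proof.
move=> dyck_col le_K; apply: (iffP andP) => [[K_gt0 /eqP cK]|[K_gt0 init]]; last first.
  by rewrite init.
split=> // t le_t; have := col_spread dyck_col (leq0n t) (leq_trans le_t le_K).
by have := col_spread dyck_col le_t le_K; lia.
Qed.

Theorem theorem4p3 (n : nat) (la : seq nat) (T T' : filling) (i m k : nat)
    (alpha beta : seq nat) :
  is_partition la n ->
  is_SYT la T ->
  dyck_pattern_interval n T i m ->
  k = unpaired_letter T i m ->
  T' = act (cycle_fun m k) T ->
  alpha = shape (phi_inv T) ->
  beta = shape (phi_inv T') ->
  (alpha <> beta <->
   ((forall x, i <= x <= k -> exists2 c, c < k - i + 1 & x \in column T c) /\
    i < k) /\
   (forall r0, i \in nth [::] T r0 -> nth 0 alpha r0.+1 < nth 0 alpha r0)).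
Proof.
move=> la_part T_syt dyckI -> -> -> -> {k T' alpha beta}.
have [m_gt0 [i_gt0 le_n] _ _] := dyckI.
have [K le_K [-> dyck_col]] := dyck_pattern_columns la_part T_syt dyckI.
have mem_xs := mem_SYT_column la_part T_syt.
have xs_sorted := sorted_SYT_column la_part T_syt.
set beta := shape (phi_inv (act _ _)); set alpha := shape (phi_inv T).
pose V e r := entry (phi_inv T) r e.
pose U e r := cycle_inv m (i + K) (entry (phi_inv (act (cycle_fun m (i + K)) T)) r e).
have [chV V0 size_alpha occV] : [/\ chain _ _ _ V, forall r, V 0 r = entry T r 0, _ &
    forall e r, (V e r == 0) = (nth 0 alpha r <= e)] := chain_phi_inv la_part T_syt.
have [chU U0 size_beta occU] : [/\ chain _ _ _ U, forall r, U 0 r = entry T r 0, _ &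
    forall e r, (U e r == 0) = (nth 0 beta r <= e)] :=
  chain_phi_inv_act la_part T_syt i_gt0 le_n le_K dyck_col.
have eq0 : V 0 =1 U 0 by move=> r; rewrite V0 U0.
(* The length of a row is the first column in which it is empty. *)
have eq_shape : (forall e r, (V e r == 0) = (U e r == 0)) -> alpha = beta.
  move=> occ; apply: (@eq_from_nth _ 0) => [|r _]; first by rewrite size_alpha.
  have := occ (nth 0 alpha r) r; have := occ (nth 0 beta r) r.
  by rewrite !occU !occV; lia.
have in_A x : 0 < x <= n -> x \in column T (col_of T x) by rewrite mem_xs eqxx andbT.
have -> : i + K - i + 1 = K.+1 by lia.
have [init|not_init] := initial_columnsP dyck_col le_K; last first.
  split=> [neq|[[cols lt_iK] _]].
    case: neq; apply: eq_shape => e r.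
    exact: (occupied_noninitial mem_xs xs_sorted i_gt0 le_n le_K dyck_col e r chV chU eq0
      not_init).
  case: not_init; apply/(initial_columnsP dyck_col le_K).
  (* Condition (I) bounds the column of a_K by K, and [col_spread] bounds it from below. *)
  have [c le_c] := cols (i + K) ltac:(lia); rewrite mem_xs => /andP[_ /eqP cK].
  by have := col_spread dyck_col (leq0n K) le_K; lia.
have [K_gt0 col_init] := init; have [col_a col_b col_low _] := dyck_col.
have i_mem : i \in flatten T by rewrite (mem_SYT la_part T_syt); lia.
have [lt_q entry_i] := entry_row_col i_mem.
set q := row_of T i in lt_q entry_i.
have ci : col_of T i = 0 by rewrite -{1}(addn0 i) col_init.
have cb : col_of T (i + m + 1) = 0 by have := col_low 1 ltac:(lia); rewrite addn0 ci; lia.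
have b_mem : i + m + 1 \in flatten T by rewrite (mem_SYT la_part T_syt); lia.
have [lt_q1 entry_b] := entry_row_col b_mem.
set q1 := row_of T (i + m + 1) in lt_q1 entry_b.
rewrite ci cb !(SYT_row_size T_syt) in lt_q lt_q1 entry_i entry_b.
have col0 r : 0 < nth 0 la r -> col_of T (entry T r 0) = 0.
  by rewrite -(SYT_row_size T_syt) => /(row_col_entry (uniq_SYT T_syt))[].
have gt_q1 : q < q1.
  by rewrite ltnNge; apply/negP => /(entry_le la_part T_syt)/(_ (leqnn 0) lt_q); lia.
(* A row between q and q1 would start with a letter between i and b_1, that is a_u with u > 0, which
   is not in column 0. *)
have eq_q1 : q1 = q.+1.
  apply/eqP; rewrite eqn_leq gt_q1 andbT leqNgt; apply/negP => lt_q2.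
  have z_lt := entry_col_lt la_part T_syt lt_q2 lt_q1.
  have in_q2 : 0 < nth 0 la q.+1 := leq_trans lt_q1 (partition_nth la_part (ltnW lt_q2)).
  have z_gt := entry_col_lt la_part T_syt (ltnSn q) in_q2.
  rewrite entry_i -[X in X < _]addn0 in z_gt; rewrite entry_b in z_lt.
  have cz := col0 _ in_q2.
  case: (letter_range z_gt z_lt) => [[u lt_u eu]|[u]]; last by lia.
  by have := col_a 0 u ltac:(lia); rewrite -eu cz.
(* A row above that of b_1 cannot start with b_u for u > 1, since b_u lies to the right of b_1. *)
rewrite eq_q1 in entry_b; have above r : q.+1 < r -> V 0 r != 0 -> i + 2 * m < V 0 r.
  rewrite V0 => lt_r z_n0; have in_r : 0 < nth 0 la r.
    by rewrite -(SYT_row_size T_syt) ltnNge; apply: contra z_n0 => /entry_default ->.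
  have z_gt := entry_col_lt la_part T_syt lt_r in_r; have cz := col0 r in_r.
  rewrite entry_b in z_gt; rewrite ltnNge; apply/negP => le_z.
  have := col_b 1 (entry T r 0 - (i + m)) ltac:(lia) ltac:(lia).
  by rewrite subnKC ?cz; lia.
have changed := occupied_initial mem_xs xs_sorted i_gt0 le_n le_K dyck_col chV chU eq0 init
  (etrans (V0 q) entry_i) (etrans (V0 q.+1) entry_b) above.
have row_i r : i \in nth [::] T r -> r = q.
  move=> ir; have lt_c : index i (nth [::] T r) < size (nth [::] T r) by rewrite index_mem.
  have [+ _] := row_col_entry (uniq_SYT T_syt) lt_c.
  by rewrite /entry nth_index.
split=> [neq|[_ lt_alpha]].
  split; [split; last by lia|].
    move=> x x_bound; exists (col_of T x); last by apply: in_A; lia.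
    by have := col_init (x - i) ltac:(lia); rewrite subnKC; lia.
  move=> r /row_i ->; rewrite ltnNge; apply/negP => ge_alpha.
  case: neq; apply: eq_shape => e r'.
  have [//|ne] := eqVneq (V e r' == 0) (U e r' == 0).
  have [|e' [Vq Vq1]] := proj1 changed; first by exists e, r'.
  by move: Vq; have := occV e' q.+1; rewrite Vq1 eqxx occV; lia.
have {}lt_alpha := lt_alpha q.
have iq : i \in nth [::] T q.
  by rewrite -{1}entry_i mem_nth // (SYT_row_size T_syt).
move=> eq_ab; have [|e [r]] := proj2 changed.
  (* The first column that is empty in row q + 1; by [lt_alpha] row q still reaches it. *)
  exists (nth 0 alpha q.+1); split; last by apply/eqP; rewrite occV.
  by rewrite occV -ltnNge lt_alpha.
by rewrite occV occU eq_ab eqxx.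
Qed.
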